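(* Let $L$ be a set. The prop $\mathrm{Circ}_L$ is the coproduct, in the category of props, of $\mathrm{FinCospan}$ and the prop $F(L)$ for $L$-actions: $\mathrm{Circ}_L\cong \mathrm{FinCospan}+F(L)$.
   Context: A prop is a strict symmetric monoidal category whose objects are the natural numbers, with tensor product of objects given by addition; a morphism of props is a strict symmetric monoidal functor that is the identity on objects. A symmetric monoidal category all of whose objects are isomorphic to tensor powers of a fixed object is equivalent to a prop, and the same name is used for that prop. $\mathrm{FinCospan}$ is the prop whose morphisms $m\to n$ are isomorphism classes of cospans of finite sets $X\to N\leftarrow Y$ with $X,Y$ finite sets of $m$ and $n$ elements, composed by pushout, tensored by disjoint union. An $L$-circuit from a finite set $X$ to a finite set $Y$ is a cospan of finite sets $X\xrightarrow{i}N\xleftarrow{o}Y$ together with an $L$-graph with node set $N$: a finite set $E$ of edges with maps $s,t\colon E\to N$ and a labelling $\ell\colon E\to L$. An isomorphism of $L$-circuits from $X$ to $Y$ is a pair of bijections $E\to E'$, $N\to N'$ commuting with $s,t,\ell,i,o$. The composite of $L$-circuits $X\to Y\to Z$ with node sets $N,N'$ and edge sets $E,E'$ is the composite cospan, with apex the pushout $N+_YN'$, with edge set $E+E'$, labelling $\langle\ell,\ell'\rangle$, and source and target maps the composites of $s+s'$, $t+t'$ with the natural map $N+N'\to N+_YN'$. The tensor product is disjoint union. $\mathrm{Circ}_L$ is the prop equivalent to the resulting symmetric monoidal category with finite sets as objects and isomorphism classes of $L$-circuits as morphisms; so a morphism $m\to n$ is an isomorphism class of $L$-circuits from an $m$-element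 set to an $n$-element set. $F(L)$ is the free prop on the signature having one generator $\ell\colon 1\to 1$ for each $\ell\in L$ and no others. *)

(* Defs.v *)
From Corelib Require Import RelationClasses.
From mathcomp Require Import all_boot.
From mathcomp Require Import boolp.

Set Implicit Arguments.
Unset Strict Implicit.
Unset Printing Implicit Defensive.

(* Tensor product of objects is addition on [nat], whose associativity and
   unit laws are not all definitional: the strict monoidal equations between
   morphisms are stated along this transport. *)
Definition hcast (H : nat -> nat -> Type) (m m' n n' : nat)
    (em : m = m') (en : n = n') (f : H m n) : H m' n' :=
  eq_rect n (H m') (eq_rect m (fun k => H k n) f m' em) n' en.

(* Composition is in diagrammatic order: [ocomp f g] is "f, then g". *)
Record prop_ops (H : nat -> nat -> Type) := PropOps {
  oid : forall n, H n n;
  ocomp : forall m n p, H m n -> H n p -> H m p;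
  otens : forall m n m' n', H m n -> H m' n' -> H (m + m') (n + n');
  obraid : forall m n, H (m + n) (n + m)
}.

Arguments oid {H} _ n.
Arguments ocomp {H} _ {m n p} f g.
Arguments otens {H} _ {m n m' n'} f g.
Arguments obraid {H} _ m n.

(* The axioms of a strict symmetric monoidal category with monoid of objects
   (nat, +, 0), up to a family of relations [E] on the hom-types; in a prop, [E]
   is equality.  Compatibility of the braiding with the unit object follows
   from [law_hexagon] and [law_braidK]. *)
Record prop_laws (H : nat -> nat -> Type) (o : prop_ops H)
    (E : forall m n, H m n -> H m n -> Prop) : Prop := PropLaws {
  law_compA : forall m n p q (f : H m n) (g : H n p) (h : H p q),
    E _ _ (ocomp o f (ocomp o g h)) (ocomp o (ocomp o f g) h);
  law_idl : forall m n (f : H m n), E _ _ (ocomp o (oid o m) f) f;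
  law_idr : forall m n (f : H m n), E _ _ (ocomp o f (oid o n)) f;
  law_tens_id : forall m n, E _ _ (otens o (oid o m) (oid o n)) (oid o (m + n));
  law_tens_comp : forall m n p m' n' p'
      (f : H m n) (g : H n p) (f' : H m' n') (g' : H n' p'),
    E _ _ (otens o (ocomp o f g) (ocomp o f' g'))
          (ocomp o (otens o f f') (otens o g g'));
  law_tensA : forall m1 n1 m2 n2 m3 n3
      (f : H m1 n1) (g : H m2 n2) (h : H m3 n3),
    E _ _ (hcast (addnA m1 m2 m3) (addnA n1 n2 n3) (otens o f (otens o g h)))
          (otens o (otens o f g) h);
  law_tens0l : forall m n (f : H m n),
    E _ _ (hcast (add0n m) (add0n n) (otens o (oid o 0) f)) f;
  law_tens0r : forall m n (f : H m n),
    E _ _ (hcast (addn0 m) (addn0 n) (otens o f (oid o 0))) f;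
  law_braid_nat : forall m n m' n' (f : H m n) (g : H m' n'),
    E _ _ (ocomp o (otens o f g) (obraid o n n'))
          (ocomp o (obraid o m m') (otens o g f));
  law_braidK : forall m n,
    E _ _ (ocomp o (obraid o m n) (obraid o n m)) (oid o (m + n));
  law_hexagon : forall m n p,
    E _ _ (obraid o m (n + p))
      (ocomp o
        (hcast (esym (addnA m n p)) (esym (addnA n m p))
           (otens o (obraid o m n) (oid o p)))
        (hcast erefl (addnA n p m) (otens o (oid o n) (obraid o m p))))
}.

Record prop := Prop_ {
  hom : nat -> nat -> Type;
  hops : prop_ops hom;
  hlaws : prop_laws hops (fun m n => @eq (hom m n))
}.

Definition pid (P : prop) n : hom P n n := oid (hops P) n.
Definition pcomp (P : prop) m n p (f : hom P m n) (g : hom P n p) : hom P m p :=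
  ocomp (hops P) f g.
Definition ptens (P : prop) m n m' n' (f : hom P m n) (g : hom P m' n') :
  hom P (m + m') (n + n') := otens (hops P) f g.
Definition pbraid (P : prop) m n : hom P (m + n) (n + m) := obraid (hops P) m n.

Arguments pid : clear implicits.
Arguments pbraid : clear implicits.

Record morphism (P Q : prop) := Morphism {
  mfun :> forall m n, hom P m n -> hom Q m n;
  mfun_id : forall n, mfun (pid P n) = pid Q n;
  mfun_comp : forall m n p (f : hom P m n) (g : hom P n p),
    mfun (pcomp f g) = pcomp (mfun f) (mfun g);
  mfun_tens : forall m n m' n' (f : hom P m n) (g : hom P m' n'),
    mfun (ptens f g) = ptens (mfun f) (mfun g);
  mfun_braid : forall m n, mfun (pbraid P m n) = pbraid Q m n
}.

Arguments mfun {P Q} _ {m n} _.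

Lemma morphism_eq (P Q : prop) (F G : morphism P Q) :
  (forall m n (f : hom P m n), F m n f = G m n f) -> F = G.
Proof.
case: F G => [F F1 F2 F3 F4] [G G1 G2 G3 G4] /= eFG.
have E : F = G.
  apply: functional_extensionality_dep => m.
  apply: functional_extensionality_dep => n.
  by apply: functional_extensionality_dep => f; apply: eFG.
subst G; congr Morphism; exact: Prop_irrelevance.
Qed.

Program Definition mor_comp (P Q R : prop) (F : morphism P Q)
    (G : morphism Q R) : morphism P R :=
  @Morphism P R (fun m n f => mfun G (mfun F f)) _ _ _ _.
Next Obligation. by rewrite !mfun_id. Qed.
Next Obligation. by rewrite !mfun_comp. Qed.
Next Obligation. by rewrite !mfun_tens. Qed.
Next Obligation. by rewrite !mfun_braid. Qed.

Definition is_coproduct (A B C : prop) (iA : morphism A C) (iB : morphism B C) :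
    Prop :=
  forall (D : prop) (F : morphism A D) (G : morphism B D),
    exists! K : morphism C D, mor_comp iA K = F /\ mor_comp iB K = G.

(* A quotient element is an equivalence class, as a predicate; [repr] picks a
   member of a class by the choice axiom of boolp. *)
Definition quot (T : Type) (R : T -> T -> Prop) : Type :=
  {P : T -> Prop | exists x, P = R x}.

Definition cls (T : Type) (R : T -> T -> Prop) (x : T) : quot R :=
  exist _ (R x) (ex_intro _ x erefl).

Definition repr (T : Type) (R : T -> T -> Prop) (q : quot R) : T :=
  projT1 (cid (proj2_sig q)).

Lemma reprK (T : Type) (R : T -> T -> Prop) (q : quot R) : cls R (repr q) = q.
Proof.
case: q => P hP; rewrite /repr /cls; case: cid => x /= eP.
by subst P; congr exist; apply: Prop_irrelevance.
Qed.

Lemma cls_eqP (T : Type) (R : T -> T -> Prop) : Equivalence R ->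
  forall x y, cls R x = cls R y <-> R x y.
Proof.
move=> [Rr Rs Rt] x y; split=> [[->] | Rxy]; first exact: Rr.
have eR : R x = R y.
  by apply/predeqP => z; split; apply: Rt => //; apply: Rs.
rewrite /cls; move: (ex_intro _ x _) (ex_intro _ y _) => /=.
by rewrite eR => p q; congr exist; apply: Prop_irrelevance.
Qed.

Lemma cls_ind (T : Type) (R : T -> T -> Prop) (P : quot R -> Prop) :
  (forall x, P (cls R x)) -> forall q, P q.
Proof. by move=> Pc q; rewrite -(reprK q). Qed.

Record congruence (H : nat -> nat -> Type) (o : prop_ops H)
    (E : forall m n, H m n -> H m n -> Prop) : Prop := Congruence {
  cong_equiv : forall m n, Equivalence (E m n);
  cong_comp : forall m n p (f f' : H m n) (g g' : H n p),
    E _ _ f f' -> E _ _ g g' -> E _ _ (ocomp o f g) (ocomp o f' g');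
  cong_tens : forall m n m' n' (f f' : H m n) (g g' : H m' n'),
    E _ _ f f' -> E _ _ g g' -> E _ _ (otens o f g) (otens o f' g')
}.

Definition quot_ops (H : nat -> nat -> Type) (o : prop_ops H)
    (E : forall m n, H m n -> H m n -> Prop) :
    prop_ops (fun m n => quot (E m n)) :=
  @PropOps (fun m n => quot (E m n))
    (fun n => cls _ (oid o n))
    (fun m n p f g => cls _ (ocomp o (repr f) (repr g)))
    (fun m n m' n' f g => cls _ (otens o (repr f) (repr g)))
    (fun m n => cls _ (obraid o m n)).

Section QuotLaws.
Variables (H : nat -> nat -> Type) (o : prop_ops H).
Variable E : forall m n, H m n -> H m n -> Prop.
Hypotheses (cE : congruence o E) (lE : prop_laws o E).

Lemma repr_cls m n (f : H m n) : E (repr (cls (@E m n) f)) f.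
Proof. by apply/(cls_eqP (cong_equiv cE m n)); rewrite reprK. Qed.

Lemma quot_comp m n p (f : H m n) (g : H n p) :
  ocomp (quot_ops o E) (cls _ f) (cls _ g) = cls _ (ocomp o f g).
Proof.
by apply/(cls_eqP (cong_equiv cE _ _))/(cong_comp cE); apply: repr_cls.
Qed.

Lemma quot_tens m n m' n' (f : H m n) (g : H m' n') :
  otens (quot_ops o E) (cls _ f) (cls _ g) = cls _ (otens o f g).
Proof.
by apply/(cls_eqP (cong_equiv cE _ _))/(cong_tens cE); apply: repr_cls.
Qed.

Lemma quot_cast m m' n n' (em : m = m') (en : n = n') (f : H m n) :
  hcast (H := fun m n => quot (@E m n)) em en (cls _ f) = cls _ (hcast em en f).
Proof. by case: m' / em; case: n' / en. Qed.

Lemma quot_laws :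
  prop_laws (quot_ops o E) (fun m n => @eq (quot (@E m n))).
Proof.
have cE' m n := cls_eqP (cong_equiv cE m n).
have oidE n : oid (quot_ops o E) n = cls _ (oid o n) by [].
have obraidE m n : obraid (quot_ops o E) m n = cls _ (obraid o m n) by [].
split.
- move=> m n p q; do 3!elim/cls_ind=> ?; rewrite !quot_comp.
  by apply/cE'; apply: (law_compA lE).
- by move=> m n; elim/cls_ind=> f; rewrite oidE quot_comp; apply/cE'/(law_idl lE).
- by move=> m n; elim/cls_ind=> f; rewrite oidE quot_comp; apply/cE'/(law_idr lE).
- by move=> m n; rewrite !oidE quot_tens; apply/cE'/(law_tens_id lE).
- move=> m n p m' n' p'; do 4!elim/cls_ind=> ?.
  by rewrite !(quot_comp, quot_tens); apply/cE'; apply: (law_tens_comp lE).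
- move=> m1 n1 m2 n2 m3 n3; do 3!elim/cls_ind=> ?.
  by rewrite !quot_tens quot_cast; apply/cE'; apply: (law_tensA lE).
- move=> m n; elim/cls_ind=> f; rewrite oidE quot_tens quot_cast.
  exact/cE'/(law_tens0l lE).
- move=> m n; elim/cls_ind=> f; rewrite oidE quot_tens quot_cast.
  exact/cE'/(law_tens0r lE).
- move=> m n m' n'; do 2!elim/cls_ind=> ?.
  rewrite !obraidE !(quot_comp, quot_tens).
  by apply/cE'; apply: (law_braid_nat lE).
- by move=> m n; rewrite !obraidE quot_comp; apply/cE'/(law_braidK lE).
- move=> m n p; rewrite !obraidE !oidE !quot_tens !quot_cast quot_comp.
  exact/cE'/(law_hexagon lE).
Qed.

Definition quot_prop : prop := Prop_ quot_laws.

End QuotLaws.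

(* A family of maps into a prop, compatible with the operations, pulls back
   equality to a congruence satisfying the prop axioms. *)
Section Pullback.
Variables (H : nat -> nat -> Type) (o : prop_ops H).
Variable E : forall m n, H m n -> H m n -> Prop.
Variables (Q : prop) (J : forall m n, H m n -> hom Q m n).
Hypothesis JE : forall m n (f g : H m n), E f g <-> J f = J g.
Hypothesis J_id : forall n, J (oid o n) = oid (hops Q) n.
Hypothesis J_comp : forall m n p (f : H m n) (g : H n p),
  J (ocomp o f g) = ocomp (hops Q) (J f) (J g).
Hypothesis J_tens : forall m n m' n' (f : H m n) (g : H m' n'),
  J (otens o f g) = otens (hops Q) (J f) (J g).
Hypothesis J_braid : forall m n, J (obraid o m n) = obraid (hops Q) m n.

Lemma pullback_cast m m' n n' (em : m = m') (en : n = n') (f : H m n) :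
  J (hcast em en f) = hcast em en (J f).
Proof. by case: m' / em; case: n' / en. Qed.

Lemma pullback_congruence : congruence o E.
Proof.
split=> [m n|m n p f f' g g'|m n m' n' f f' g g'].
- split=> [f|f g /JE e|f g h /JE e /JE e']; apply/JE => //.
  exact: etrans e'.
- by move=> /JE e /JE e'; apply/JE; rewrite !J_comp e e'.
- by move=> /JE e /JE e'; apply/JE; rewrite !J_tens e e'.
Qed.

Lemma pullback_laws : prop_laws o E.
Proof.
have lQ := hlaws Q.
split=> *; apply/JE;
  rewrite !(J_comp, pullback_cast, J_tens, J_id, J_braid);
  [ apply: (law_compA lQ) | apply: (law_idl lQ) | apply: (law_idr lQ)
  | apply: (law_tens_id lQ) | apply: (law_tens_comp lQ) | apply: (law_tensA lQ)
  | apply: (law_tens0l lQ) | apply: (law_tens0r lQ) | apply: (law_braid_nat lQ)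
  | apply: (law_braidK lQ) | apply: (law_hexagon lQ) ].
Qed.

End Pullback.

(* [S m n] is the set of generators m -> n. *)
Definition signature := nat -> nat -> Type.

Inductive term (S : signature) : nat -> nat -> Type :=
| tgen m n : S m n -> term S m n
| tid n : term S n n
| tcomp m n p : term S m n -> term S n p -> term S m p
| ttens m n m' n' : term S m n -> term S m' n' -> term S (m + m') (n + n')
| tbraid m n : term S (m + n) (n + m).

Arguments tgen {S m n} _.

Definition term_ops (S : signature) : prop_ops (term S) :=
  PropOps (@tid S) (@tcomp S) (@ttens S) (@tbraid S).

(* The least congruence on terms for which the prop axioms hold. *)
Definition term_eq (S : signature) (m n : nat) (t u : term S m n) : Prop :=
  forall E : forall m n, term S m n -> term S m n -> Prop,
    congruence (term_ops S) E -> prop_laws (term_ops S) E -> E m n t u.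

Lemma term_eq_congruence (S : signature) :
  congruence (term_ops S) (@term_eq S).
Proof.
split.
- move=> m n; split.
  + by move=> t E cE lE; have [r _ _] := cong_equiv cE m n; apply: r.
  + move=> t u tu E cE lE; have [_ s _] := cong_equiv cE m n.
    by apply: s; apply: tu.
  + move=> t u v tu uv E cE lE; have [_ _ tr] := cong_equiv cE m n.
    by apply: (tr _ u); [apply: tu | apply: uv].
- move=> m n p f f' g g' ef eg E cE lE.
  by apply: (cong_comp cE); [apply: ef | apply: eg].
- move=> m n m' n' f f' g g' ef eg E cE lE.
  by apply: (cong_tens cE); [apply: ef | apply: eg].
Qed.

Lemma term_eq_laws (S : signature) : prop_laws (term_ops S) (@term_eq S).
Proof.
split=> *; move=> E cE lE;
  [ apply: (law_compA lE) | apply: (law_idl lE) | apply: (law_idr lE)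
  | apply: (law_tens_id lE) | apply: (law_tens_comp lE) | apply: (law_tensA lE)
  | apply: (law_tens0l lE) | apply: (law_tens0r lE) | apply: (law_braid_nat lE)
  | apply: (law_braidK lE) | apply: (law_hexagon lE) ].
Qed.

Definition FreeProp (S : signature) : prop :=
  quot_prop (term_eq_congruence S) (term_eq_laws S).

Definition free_gen (S : signature) m n (x : S m n) : hom (FreeProp S) m n :=
  cls _ (tgen x).

Section FreeUniversal.
Variables (S : signature) (D : prop) (g : forall m n, S m n -> hom D m n).

Fixpoint term_eval m n (t : term S m n) : hom D m n :=
  match t with
  | tgen _ _ x => g x
  | tid n => pid D n
  | tcomp _ _ _ t u => pcomp (term_eval t) (term_eval u)
  | ttens _ _ _ _ t u => ptens (term_eval t) (term_eval u)
  | tbraid m n => pbraid D m n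
  end.

Lemma term_eval_eq m n (t u : term S m n) :
  term_eq t u -> term_eval t = term_eval u.
Proof.
move=> tu; apply: (tu (fun k l v w => term_eval v = term_eval w)).
  exact: (@pullback_congruence _ _ _ D term_eval).
exact: (@pullback_laws _ _ _ D term_eval).
Qed.

Lemma term_eval_cls m n (t : term S m n) :
  term_eval (repr (cls (@term_eq S m n) t)) = term_eval t.
Proof. by apply: term_eval_eq; apply: (repr_cls (term_eq_congruence S)). Qed.

Lemma FreeProp_universal :
  exists! F : morphism (FreeProp S) D,
    forall m n (x : S m n), F m n (free_gen x) = g x.
Proof.
have cS := term_eq_congruence S.
pose F0 m n (f : hom (FreeProp S) m n) := term_eval (repr f).
have F_id n : F0 _ _ (pid (FreeProp S) n) = pid D n by exact: term_eval_cls.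
have F_comp m n p (f : hom (FreeProp S) m n) (h : hom (FreeProp S) n p) :
  F0 _ _ (pcomp f h) = pcomp (F0 _ _ f) (F0 _ _ h) by exact: term_eval_cls.
have F_tens m n m' n' (f : hom (FreeProp S) m n) (h : hom (FreeProp S) m' n') :
  F0 _ _ (ptens f h) = ptens (F0 _ _ f) (F0 _ _ h) by exact: term_eval_cls.
have F_braid m n : F0 _ _ (pbraid (FreeProp S) m n) = pbraid D m n.
  exact: term_eval_cls.
exists (Morphism F_id F_comp F_tens F_braid); split.
  by move=> m n x; exact: term_eval_cls.
move=> G Gg; apply: morphism_eq => m n; elim/cls_ind=> t /=.
rewrite /F0 term_eval_cls.
elim: t => {m n} [m n x|n|m n p t IHt u IHu|m n m' n' t IHt u IHu|m n] /=.
- by rewrite -Gg.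
- by rewrite -(mfun_id G).
- by rewrite IHt IHu -(mfun_comp G); congr (mfun G _); apply: (quot_comp cS).
- by rewrite IHt IHu -(mfun_tens G); congr (mfun G _); apply: (quot_tens cS).
- by rewrite -(mfun_braid G).
Qed.

End FreeUniversal.

Inductive action_gen (L : Type) : signature :=
| action_label : L -> action_gen L 1 1.

Definition FreeAction (L : Type) : prop := FreeProp (action_gen L).

Definition sum_case (A B T : Type) (f : A -> T) (g : B -> T) (u : A + B) : T :=
  match u with inl x => f x | inr y => g y end.

Definition sum_map (A A' B B' : Type) (f : A -> A') (g : B -> B')
    (u : A + B) : A' + B' :=
  match u with inl x => inl (f x) | inr y => inr (g y) end.

(* The pushout of A <-f- Y -g-> B is the set of connected components of A + B
   for the relation linking [inl (f y)] to [inr (g y)]; a component is given by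
   its canonical representative. *)
Definition glue (Y A B : finType) (f : Y -> A) (g : Y -> B) : rel (A + B) :=
  fun u v => [exists y, (u == inl (f y)) && (v == inr (g y))
                     || (v == inl (f y)) && (u == inr (g y))].

Lemma glue_sym (Y A B : finType) (f : Y -> A) (g : Y -> B) :
  connect_sym (glue f g).
Proof.
apply: sym_connect_sym => u v; rewrite /glue.
by apply: eq_existsb => y; rewrite orbC.
Qed.

Definition pushout (Y A B : finType) (f : Y -> A) (g : Y -> B) : finType :=
  {u : A + B | roots (glue f g) u}.

Definition po_in (Y A B : finType) (f : Y -> A) (g : Y -> B) (u : A + B) :
    pushout f g :=
  exist _ (root (glue f g) u) (roots_root (glue_sym f g) u).

Definition po_desc (Y A B : finType) (f : Y -> A) (g : Y -> B) (T : Type)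
    (a : A -> T) (b : B -> T) (q : pushout f g) : T :=
  sum_case a b (val q).

Section Pushout.
Variables (Y A B : finType) (f : Y -> A) (g : Y -> B).
Notation inj := (po_in f g).

Lemma po_glue y : inj (inl (f y)) = inj (inr (g y)).
Proof.
apply: val_inj; apply/(rootP (glue_sym f g))/connect1/existsP.
by exists y; rewrite !eqxx.
Qed.

Lemma po_ind (P : pushout f g -> Prop) : (forall u, P (inj u)) -> forall q, P q.
Proof.
move=> Pi q; have -> : q = inj (val q) by apply: val_inj; rewrite /= (eqP (valP q)).
exact: Pi.
Qed.

Lemma po_descE (T : Type) (a : A -> T) (b : B -> T) :
  (forall y, a (f y) = b (g y)) ->
  forall u, po_desc a b (inj u) = sum_case a b u.
Proof.
move=> ab u; rewrite /po_desc /=.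
have /connectP[p] := connect_root (glue f g) u.
elim: p u (root _ _) => [|v p IHp] u w /= => [_ -> //|/andP[uv pv] ew].
rewrite (IHp v w pv ew); case/existsP: uv => y.
by case/orP=> /andP[/eqP-> /eqP->] /=; rewrite ab.
Qed.

Lemma po_universal (T : Type) (a : A -> T) (b : B -> T) :
  (forall y, a (f y) = b (g y)) ->
  exists! h : pushout f g -> T,
    (forall x, h (inj (inl x)) = a x) /\ (forall y, h (inj (inr y)) = b y).
Proof.
move=> ab; exists (po_desc a b); split; first by split=> x; rewrite po_descE.
move=> h [ha hb]; apply/funext; elim/po_ind=> u.
by rewrite po_descE //; case: u => x /=.
Qed.

End Pushout.

Record cospan (m n : nat) := Cospan {
  apex : finType;
  lleg : 'I_m -> apex;
  rleg : 'I_n -> apex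
}.

Definition cospan_iso m n (c d : cospan m n) (h : apex c -> apex d) : Prop :=
  [/\ bijective h, forall x, h (lleg c x) = lleg d x
    & forall y, h (rleg c y) = rleg d y].

Definition cospan_eq m n (c d : cospan m n) : Prop :=
  exists h, cospan_iso (c := c) (d := d) h.

Definition cospan_comp m n p (c : cospan m n) (d : cospan n p) : cospan m p :=
  @Cospan m p (pushout (rleg c) (lleg d))
    (fun x => po_in _ _ (inl (lleg c x))) (fun z => po_in _ _ (inr (rleg d z))).

(* 'I_(m + n) is the disjoint union of 'I_m and 'I_n through [split]. *)
Definition cospan_tens m n m' n' (c : cospan m n) (d : cospan m' n') :
    cospan (m + m') (n + n') :=
  @Cospan (m + m') (n + n') (apex c + apex d)%type
    (fun x => sum_map (lleg c) (lleg d) (split x))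
    (fun y => sum_map (rleg c) (rleg d) (split y)).

(* The cospan 'I_m -id-> 'I_m <-s- 'I_n. *)
Definition cospan_fn m n (s : 'I_n -> 'I_m) : cospan m n :=
  @Cospan m n 'I_m id s.

Definition swap_ord m n (x : 'I_(n + m)) : 'I_(m + n) :=
  match split x with inl j => rshift m j | inr i => lshift n i end.

Definition cospan_ops : prop_ops cospan :=
  PropOps (fun n => @cospan_fn n n id) cospan_comp cospan_tens
    (fun m n => cospan_fn (@swap_ord m n)).

Record lgraph (L : Type) (N : finType) := LGraph {
  edge : finType;
  src : edge -> N;
  tgt : edge -> N;
  lab : edge -> L
}.

Arguments src {L N} _ _.
Arguments tgt {L N} _ _.
Arguments lab {L N} _ _.

Record circuit (L : Type) (m n : nat) := Circuit {
  circ_cospan :> cospan m n;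
  circ_graph :> lgraph L (apex circ_cospan)
}.

Definition circuit_eq L m n (c d : circuit L m n) : Prop :=
  exists (h : apex c -> apex d) (k : edge c -> edge d),
    [/\ cospan_iso h, bijective k,
        forall e, src d (k e) = h (src c e),
        forall e, tgt d (k e) = h (tgt c e)
      & forall e, lab d (k e) = lab c e].

Definition no_edges L (N : finType) : lgraph L N :=
  @LGraph L N void (of_void N) (of_void N) (of_void L).

Definition circuit_comp L m n p (c : circuit L m n) (d : circuit L n p) :
    circuit L m p :=
  @Circuit L m p (cospan_comp c d)
    (@LGraph L (apex (cospan_comp c d)) (edge c + edge d)%type
      (fun e => po_in _ _ (sum_map (src c) (src d) e))
      (fun e => po_in _ _ (sum_map (tgt c) (tgt d) e))
      (sum_case (lab c) (lab d))).

Definition circuit_tens L m n m' n' (c : circuit L m n) (d : circuit L m' n') :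
    circuit L (m + m') (n + n') :=
  @Circuit L (m + m') (n + n') (cospan_tens c d)
    (@LGraph L (apex (cospan_tens c d)) (edge c + edge d)%type
      (sum_map (src c) (src d)) (sum_map (tgt c) (tgt d))
      (sum_case (lab c) (lab d))).

Definition circuit_of_cospan L m n (c : cospan m n) : circuit L m n :=
  Circuit (no_edges L (apex c)).

Definition circuit_ops L : prop_ops (circuit L) :=
  PropOps (fun n => circuit_of_cospan L (oid cospan_ops n))
    (@circuit_comp L) (@circuit_tens L)
    (fun m n => circuit_of_cospan L (obraid cospan_ops m n)).

Section CircuitLaws.
Variable L : Type.

Lemma circuit_eq_equiv m n : Equivalence (@circuit_eq L m n).
Proof.
split.
- move=> c; exists id, id; split=> //; last by exists id.
  by split=> //; exists id.
- move=> c d [h [k [[[h' hK Kh] hl hr] [k' kK Kk] ks kt kl]]].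
  exists h', k'; split.
  + split; first by exists h.
    * by move=> x; rewrite -hl hK.
    * by move=> x; rewrite -hr hK.
  + by exists k.
  + by move=> e; rewrite -{2}(Kk e) ks hK.
  + by move=> e; rewrite -{2}(Kk e) kt hK.
  + by move=> e; rewrite -{2}(Kk e) kl.
- move=> c d e [h [k [[bh hl hr] bk ks kt kl]]].
  move=> [h' [k' [[bh' hl' hr'] bk' ks' kt' kl']]].
  exists (h' \o h), (k' \o k); split; try exact: bij_comp.
  + split; first exact: bij_comp.
    * by move=> x /=; rewrite hl hl'.
    * by move=> x /=; rewrite hr hr'.
  + by move=> x /=; rewrite ks' ks.
  + by move=> x /=; rewrite kt' kt.
  + by move=> x /=; rewrite kl' kl.
Qed.

Lemma circuit_eq_sym m n (c d : circuit L m n) :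
  circuit_eq c d -> circuit_eq d c.
Proof. by have [_ + _] := circuit_eq_equiv m n; apply. Qed.

Lemma circuit_eq_trans m n (c d e : circuit L m n) :
  circuit_eq c d -> circuit_eq d e -> circuit_eq c e.
Proof. by have [_ _ +] := circuit_eq_equiv m n; apply. Qed.

(* A circuit [e] whose apex carries the pushout cocone [a], [b] (with [g] the
   comparison map to the chosen pushout) is a composite of [c] and [d]. *)
Lemma circuit_comp_eq m n p (c : circuit L m n) (d : circuit L n p)
    (e : circuit L m p) (a : apex c -> apex e) (b : apex d -> apex e)
    (g : apex e -> apex (cospan_comp c d)) (k : edge c + edge d -> edge e) :
    (forall y, a (rleg c y) = b (lleg d y)) ->
    (forall x, g (a x) = po_in _ _ (inl x)) ->
    (forall y, g (b y) = po_in _ _ (inr y)) ->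
    (forall z, (exists x, z = a x) \/ (exists y, z = b y)) ->
    (forall x, lleg e x = a (lleg c x)) ->
    (forall x, rleg e x = b (rleg d x)) ->
    bijective k ->
    (forall u, src e (k u) = sum_case a b (sum_map (src c) (src d) u)) ->
    (forall u, tgt e (k u) = sum_case a b (sum_map (tgt c) (tgt d) u)) ->
    (forall u, lab e (k u) = sum_case (lab c) (lab d) u) ->
  circuit_eq (circuit_comp c d) e.
Proof.
move=> ab ga gb surj el er bk ks kt kl.
exists (po_desc a b), k; split=> //.
- split.
  + exists g.
      by elim/po_ind=> u; rewrite po_descE //; case: u => x /=.
    by move=> z; case: (surj z) => -[x ->]; rewrite ?ga ?gb po_descE.
  + by move=> x; rewrite po_descE.
  + by move=> x; rewrite po_descE.
- by move=> u; rewrite ks /= po_descE.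
- by move=> u; rewrite kt /= po_descE.
Qed.

Lemma sum_map_bij (A A' B B' : Type) (f : A -> A') (g : B -> B') :
  bijective f -> bijective g -> bijective (sum_map f g).
Proof.
move=> [f' fK Kf] [g' gK Kg].
by exists (sum_map f' g') => -[x|x] /=; rewrite ?fK ?Kf ?gK ?Kg.
Qed.

Lemma circuit_congruence : congruence (circuit_ops L) (@circuit_eq L).
Proof.
split; first exact: circuit_eq_equiv.
- move=> m n p c c' d d' [h [k [[[h' hK Kh] hl hr] bk ks kt kl]]].
  move=> [i [j [[[i' iK Ki] il ir] bj js jt jl]]].
  apply: (@circuit_comp_eq _ _ _ c d (circuit_comp c' d')
     (fun x => po_in _ _ (inl (h x))) (fun y => po_in _ _ (inr (i y)))
     (po_desc (fun x => po_in _ _ (inl (h' x)))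
              (fun y => po_in _ _ (inr (i' y)))) (sum_map k j)) => /=.
  + by move=> y; rewrite hr il po_glue.
  + move=> x; rewrite po_descE /= ?hK // => y.
    by rewrite -hr -il hK iK po_glue.
  + move=> x; rewrite po_descE /= ?iK // => y.
    by rewrite -hr -il hK iK po_glue.
  + elim/po_ind=> -[x|x]; [left; exists (h' x) | right; exists (i' x)];
      by rewrite ?Kh ?Ki.
  + by move=> x; rewrite hl.
  + by move=> x; rewrite ir.
  + exact: sum_map_bij.
  + by case=> e /=; rewrite ?ks ?js.
  + by case=> e /=; rewrite ?kt ?jt.
  + by case=> e /=; rewrite ?kl ?jl.
- move=> m n m' n' c c' d d' [h [k [[bh hl hr] bk ks kt kl]]].
  move=> [i [j [[bi il ir] bj js jt jl]]].
  exists (sum_map h i), (sum_map k j); split; try exact: sum_map_bij.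
  + split; first exact: sum_map_bij.
    * by move=> x /=; case: (split x) => y /=; rewrite ?hl ?il.
    * by move=> x /=; case: (split x) => y /=; rewrite ?hr ?ir.
  + by case=> e /=; rewrite ?ks ?js.
  + by case=> e /=; rewrite ?kt ?jt.
  + by case=> e /=; rewrite ?kl ?jl.
Qed.

Lemma circuit_compA m n p q (c : circuit L m n) (d : circuit L n p)
    (e : circuit L p q) :
  circuit_eq (circuit_comp c (circuit_comp d e))
             (circuit_comp (circuit_comp c d) e).
Proof.
pose k (u : edge c + (edge d + edge e)) : (edge c + edge d) + edge e :=
  match u with inl x => inl (inl x) | inr (inl y) => inl (inr y)
             | inr (inr z) => inr z end.
pose k' (u : (edge c + edge d) + edge e) : edge c + (edge d + edge e) :=
  match u with inl (inl x) => inl x | inl (inr y) => inr (inl y)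
             | inr z => inr (inr z) end.
have glb y : po_in (rleg (cospan_comp c d)) (lleg e)
    (inl (po_in _ _ (inr (rleg d y)))) = po_in _ _ (inr (lleg e y)).
  exact: (po_glue (rleg (cospan_comp c d)) (lleg e) y).
have glg y : po_in (rleg c) (lleg (cospan_comp d e)) (inl (rleg c y)) =
    po_in _ _ (inr (po_in _ _ (inl (lleg d y)))).
  exact: (po_glue (rleg c) (lleg (cospan_comp d e)) y).
pose a x : apex (cospan_comp (cospan_comp c d) e) :=
  po_in _ _ (inl (po_in (rleg c) (lleg d) (inl x))).
pose b : apex (cospan_comp d e) -> apex (cospan_comp (cospan_comp c d) e) :=
  po_desc (fun y => po_in _ _ (inl (po_in (rleg c) (lleg d) (inr y))))
          (fun z => po_in _ _ (inr z)).
pose g1 : apex (cospan_comp c d) -> apex (cospan_comp c (cospan_comp d e)) :=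
  po_desc (fun x => po_in _ _ (inl x))
          (fun y => po_in _ _ (inr (po_in (rleg d) (lleg e) (inl y)))).
pose g : apex (cospan_comp (cospan_comp c d) e) ->
    apex (cospan_comp c (cospan_comp d e)) :=
  po_desc g1 (fun z => po_in _ _ (inr (po_in (rleg d) (lleg e) (inr z)))).
have bE u : b (po_in _ _ u) = sum_case
    (fun y => po_in _ _ (inl (po_in (rleg c) (lleg d) (inr y))))
    (fun z => po_in _ _ (inr z)) u by exact: po_descE.
have g1E u : g1 (po_in _ _ u) = sum_case (fun x => po_in _ _ (inl x))
    (fun y => po_in _ _ (inr (po_in (rleg d) (lleg e) (inl y)))) u.
  exact: po_descE.
have gE u : g (po_in _ _ u) = sum_case g1
    (fun z => po_in _ _ (inr (po_in (rleg d) (lleg e) (inr z)))) u.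
  by apply: po_descE => y /=; rewrite g1E /= po_glue.
apply: (@circuit_comp_eq _ _ _ c (circuit_comp d e)
  (circuit_comp (circuit_comp c d) e) a b g k) => /=.
- by move=> y; rewrite bE /= /a po_glue.
- by move=> x; rewrite gE /= g1E.
- by elim/po_ind=> -[y|z]; rewrite bE /= gE //= g1E.
- elim/po_ind=> -[|z].
    elim/po_ind=> -[x|y]; first by left; exists x.
    by right; exists (po_in _ _ (inl y)); rewrite bE.
  by right; exists (po_in _ _ (inr z)); rewrite bE.
- by [].
- by move=> x; rewrite bE.
- by exists k' => [[x|[x|x]]|[[x|x]|x]].
- by case=> [x|[x|x]] /=; rewrite ?bE.
- by case=> [x|[x|x]] /=; rewrite ?bE.
- by case=> [x|[x|x]] /=.
Qed.

Lemma circuit_tens_comp m n p m' n' p' (c : circuit L m n) (d : circuit L n p)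
    (c' : circuit L m' n') (d' : circuit L n' p') :
  circuit_eq (circuit_tens (circuit_comp c d) (circuit_comp c' d'))
             (circuit_comp (circuit_tens c c') (circuit_tens d d')).
Proof.
apply: circuit_eq_sym.
pose k (u : (edge c + edge c') + (edge d + edge d')) :
    (edge c + edge d) + (edge c' + edge d') :=
  match u with inl (inl x) => inl (inl x) | inl (inr x) => inr (inl x)
             | inr (inl x) => inl (inr x) | inr (inr x) => inr (inr x) end.
pose k' (u : (edge c + edge d) + (edge c' + edge d')) :
    (edge c + edge c') + (edge d + edge d') :=
  match u with inl (inl x) => inl (inl x) | inl (inr x) => inr (inl x)
             | inr (inl x) => inl (inr x) | inr (inr x) => inr (inr x) end.
have gl1 y : po_in (rleg (cospan_tens c c')) (lleg (cospan_tens d d'))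
    (inl (inl (rleg c y))) = po_in _ _ (inr (inl (lleg d y))).
  have := po_glue (rleg (cospan_tens c c')) (lleg (cospan_tens d d'))
            (lshift n' y).
  by rewrite /= (unsplitK (inl y)).
have gl2 y : po_in (rleg (cospan_tens c c')) (lleg (cospan_tens d d'))
    (inl (inr (rleg c' y))) = po_in _ _ (inr (inr (lleg d' y))).
  have := po_glue (rleg (cospan_tens c c')) (lleg (cospan_tens d d'))
            (rshift n y).
  by rewrite /= (unsplitK (inr y)).
apply: (@circuit_comp_eq _ _ _ (circuit_tens c c') (circuit_tens d d')
   (circuit_tens (circuit_comp c d) (circuit_comp c' d'))
   (sum_map (fun x => po_in (rleg c) (lleg d) (inl x))
            (fun x => po_in (rleg c') (lleg d') (inl x)))
   (sum_map (fun x => po_in (rleg c) (lleg d) (inr x))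
            (fun x => po_in (rleg c') (lleg d') (inr x)))
   (sum_case (po_desc (fun x => po_in _ _ (inl (inl x)))
                      (fun x => po_in _ _ (inr (inl x))))
             (po_desc (fun x => po_in _ _ (inl (inr x)))
                      (fun x => po_in _ _ (inr (inr x)))))
   k) => /=.
- by move=> y; case: (split y) => z /=; rewrite po_glue.
- by case=> x /=; rewrite po_descE.
- by case=> x /=; rewrite po_descE.
- by case; elim/po_ind=> -[x|x];
    [left; exists (inl x)|right; exists (inl x)
    |left; exists (inr x)|right; exists (inr x)].
- by move=> x; case: (split x).
- by move=> x; case: (split x).
- by exists k' => -[[]|[]].
- by case=> -[].
- by case=> -[].
- by case=> -[].
Qed.

Lemma sum_void_bij (A B : Type) (f : void -> B) (k : A -> B) :
  bijective k -> bijective (sum_case k f).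
Proof.
by case=> k' kK Kk; exists (fun x => inl (k' x)) => [[x|[]]|x] /=;
  rewrite ?kK ?Kk.
Qed.

Definition rleg_map m n p (c : circuit L m n) (s : 'I_p -> 'I_n) :
    circuit L m p :=
  @Circuit L m p (Cospan (lleg c) (fun x => rleg c (s x))) (circ_graph c).

Definition lleg_map m n p (c : circuit L m n) (s : 'I_p -> 'I_m) :
    circuit L p n :=
  @Circuit L p n (Cospan (fun x => lleg c (s x)) (rleg c)) (circ_graph c).

Definition circuit_fn m n (s : 'I_n -> 'I_m) : circuit L m n :=
  circuit_of_cospan L (cospan_fn s).

Lemma circuit_comp_fnr m n p (c : circuit L m n) (s : 'I_p -> 'I_n) :
  circuit_eq (circuit_comp c (circuit_fn s)) (rleg_map c s).
Proof.
apply: (@circuit_comp_eq _ _ _ c (circuit_fn s) (rleg_map c s)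
   id (rleg c) (fun x => po_in _ _ (inl x)) (sum_case id (of_void _))) => //=.
- by move=> y; rewrite po_glue.
- by move=> z; left; exists z.
- by apply: sum_void_bij; exists id.
- by case=> [|[]].
- by case=> [|[]].
- by case=> [|[]].
Qed.

Lemma circuit_comp_fnl m n p (c : circuit L n p) (s : 'I_n -> 'I_m)
    (s' : 'I_m -> 'I_n) : cancel s s' -> cancel s' s ->
  circuit_eq (circuit_comp (circuit_fn s) c) (lleg_map c s').
Proof.
move=> sK Ks.
apply: (@circuit_comp_eq _ _ _ (circuit_fn s) c (lleg_map c s')
   (fun x => lleg c (s' x)) id (fun x => po_in _ _ (inr x))
   (fun u => match u with inl x => of_void _ x | inr y => y end)) => //=.
- by move=> y; rewrite sK.
- by move=> x; rewrite -po_glue /= Ks.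
- by move=> z; right; exists z.
- by exists inr => // -[[]|].
- by case=> [[]|].
- by case=> [[]|].
- by case=> [[]|].
Qed.

Definition circuit_recast m m' n n' (em : m = m') (en : n = n')
    (c : circuit L m n) : circuit L m' n' :=
  rleg_map (lleg_map c (cast_ord (esym em))) (cast_ord (esym en)).

Lemma circuit_cast m m' n n' (em : m = m') (en : n = n') (c : circuit L m n) :
  hcast em en c = circuit_recast em en c.
Proof.
case: m' / em; case: n' / en; rewrite /circuit_recast /rleg_map /lleg_map /=.
case: c => [[N i o] G] /=.
have {1}-> : i = (fun x => i (cast_ord (erefl m) x)).
  by apply/funext => x; rewrite cast_ord_id.
have {1}-> // : o = (fun x => o (cast_ord (erefl n) x)).
by apply/funext => x; rewrite cast_ord_id.
Qed.

Lemma circuit_ext m n (c : circuit L m n) (i : 'I_m -> apex c)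
    (o : 'I_n -> apex c) :
  lleg c =1 i -> rleg c =1 o ->
  circuit_eq c (@Circuit L m n (Cospan i o) (circ_graph c)).
Proof.
move=> il or; exists id, id; split=> //; last by exists id.
by split=> //; exists id.
Qed.

Lemma split_l m n (i : 'I_m) : split (lshift n i) = inl i.
Proof. exact: (unsplitK (inl i)). Qed.

Lemma split_r m n (j : 'I_n) : split (rshift m j) = inr j.
Proof. exact: (unsplitK (inr j)). Qed.

Lemma split_addnA m n p (e : m + n + p = m + (n + p)) (x : 'I_(m + n + p)) :
  split (cast_ord e x) =
    match split x with
    | inl y => match split y with inl i => inl i | inr j => inr (lshift p j) end
    | inr k => inr (rshift n k)
    end.
Proof.
case: (split_ordP x) => [y|k] ->.
  case: (split_ordP y) => [i|j] ->.
    rewrite -(split_l (n + p) i); congr split; exact: val_inj.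
  rewrite -(split_r m (lshift p j)); congr split; exact: val_inj.
rewrite -(split_r m (rshift n k)); congr split; apply: val_inj => /=.
by rewrite addnA.
Qed.

Lemma circuit_tensA m1 n1 m2 n2 m3 n3 (c : circuit L m1 n1)
    (d : circuit L m2 n2) (e : circuit L m3 n3) :
  circuit_eq
    (hcast (addnA m1 m2 m3) (addnA n1 n2 n3) (circuit_tens c (circuit_tens d e)))
    (circuit_tens (circuit_tens c d) e).
Proof.
rewrite circuit_cast.
pose k (A B C : Type) (u : A + (B + C)) : (A + B) + C :=
  match u with inl x => inl (inl x) | inr (inl y) => inl (inr y)
             | inr (inr z) => inr z end.
pose k' (A B C : Type) (u : (A + B) + C) : A + (B + C) :=
  match u with inl (inl x) => inl x | inl (inr y) => inr (inl y)
             | inr z => inr (inr z) end.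
have bk A B C : bijective (@k A B C).
  by exists (@k' A B C) => [[x|[x|x]]|[[x|x]|x]].
exists (@k _ _ _), (@k _ _ _); split=> //=.
- split=> //= x; rewrite split_addnA; case: (split x) => y /=.
  + by case: (split y) => z //=; rewrite split_l.
  + by rewrite split_r.
  + by case: (split y) => z //=; rewrite split_l.
  + by rewrite split_r.
- by case=> [|[]].
- by case=> [|[]].
- by case=> [|[]].
Qed.

Lemma circuit_tens0l m n (c : circuit L m n) :
  circuit_eq (hcast (add0n m) (add0n n) (circuit_tens (circuit_fn (@id 'I_0)) c))
             c.
Proof.
rewrite circuit_cast.
have nI0 (T : Type) : 'I_0 -> T by case.
have bk A B (f : A -> B) : (A -> False) -> bijective (sum_case f (@id B)).
  by move=> A0; exists inr => // -[a|] //; case: (A0 a).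
have spl p (e : p = 0 + p) (x : 'I_p) : split (cast_ord e x) = inr x.
  rewrite -(split_r 0 x); congr split; exact: val_inj.
exists (sum_case (nI0 _) id), (sum_case (of_void _) id); split=> /=.
- split; first by apply: bk => -[].
  + by move=> x /=; rewrite spl.
  + by move=> x /=; rewrite spl.
- by apply: bk => -[].
- by case=> [[]|].
- by case=> [[]|].
- by case=> [[]|].
Qed.

Lemma circuit_tens0r m n (c : circuit L m n) :
  circuit_eq (hcast (addn0 m) (addn0 n) (circuit_tens c (circuit_fn (@id 'I_0))))
             c.
Proof.
rewrite circuit_cast.
have nI0 (T : Type) : 'I_0 -> T by case.
have bk A B (f : A -> B) : (A -> False) -> bijective (sum_case (@id B) f).
  by move=> A0; exists inl => // -[|a] //; case: (A0 a).
have spl p (e : p = p + 0) (x : 'I_p) : split (cast_ord e x) = inl x.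
  rewrite -(split_l 0 x); congr split; exact: val_inj.
exists (sum_case id (nI0 _)), (sum_case id (of_void _)); split=> /=.
- split; first by apply: bk => -[].
  + by move=> x /=; rewrite spl.
  + by move=> x /=; rewrite spl.
- by apply: bk => -[].
- by case=> [|[]].
- by case=> [|[]].
- by case=> [|[]].
Qed.

Lemma swap_ordK m n : cancel (@swap_ord m n) (@swap_ord n m).
Proof.
move=> x; rewrite /swap_ord; by case: (split_ordP x) => j ->; rewrite ?split_l ?split_r.
Qed.

Lemma circuit_braid_nat m n m' n' (c : circuit L m n) (d : circuit L m' n') :
  circuit_eq
    (circuit_comp (circuit_tens c d) (circuit_fn (@swap_ord n n')))
    (circuit_comp (circuit_fn (@swap_ord m m')) (circuit_tens d c)).
Proof.
apply: circuit_eq_trans (circuit_comp_fnr _ _) _.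
apply: circuit_eq_sym.
apply: circuit_eq_trans (circuit_comp_fnl _ (@swap_ordK _ _) (@swap_ordK _ _)) _.
pose sw (A B : Type) (u : A + B) : B + A :=
  match u with inl x => inr x | inr y => inl y end.
have bsw A B : bijective (@sw A B) by exists (@sw B A) => -[].
exists (@sw _ _), (@sw _ _); split=> //=.
- split=> //= x; rewrite /swap_ord; case: (split x) => y /=;
    by rewrite ?split_l ?split_r.
- by case.
- by case.
- by case.
Qed.

Lemma circuit_comp_fn m n p (s : 'I_n -> 'I_m) (t : 'I_p -> 'I_n)
    (r : 'I_p -> 'I_m) : (forall x, s (t x) = r x) ->
  circuit_eq (circuit_comp (circuit_fn s) (circuit_fn t)) (circuit_fn r).
Proof.
move=> str; apply: circuit_eq_trans (circuit_comp_fnr _ _) _.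
exact: circuit_ext.
Qed.

Lemma circuit_tens_fn m n m' n' (s : 'I_n -> 'I_m) (t : 'I_n' -> 'I_m') :
  circuit_eq (circuit_tens (circuit_fn s) (circuit_fn t))
    (circuit_fn (fun x => unsplit (sum_map s t (split x)))).
Proof.
exists (@unsplit _ _), (sum_case id id); split=> /=; try by do 2!case.
- split=> //=.
    by exists (@split m m'); [apply: unsplitK | apply: splitK].
  by move=> x; case: (split_ordP x) => y -> /=; rewrite ?split_l ?split_r.
- by exists inl; do ?case.
Qed.

Lemma circuit_cast_fn m m' n n' (em : m = m') (en : n = n') (s : 'I_n -> 'I_m) :
  hcast em en (circuit_fn s) =
    circuit_fn (fun x => cast_ord em (s (cast_ord (esym en) x))).
Proof.
case: m' / em; case: n' / en => /=; congr circuit_fn.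
by apply/funext => x; rewrite !cast_ord_id.
Qed.

Lemma circuit_cast_eq m m' n n' (em : m = m') (en : n = n')
    (c d : circuit L m n) :
  circuit_eq c d -> circuit_eq (hcast em en c) (hcast em en d).
Proof. by case: m' / em; case: n' / en. Qed.

Lemma circuit_hexagon m n p :
  circuit_eq (circuit_fn (@swap_ord m (n + p)))
    (circuit_comp
      (hcast (esym (addnA m n p)) (esym (addnA n m p))
        (circuit_tens (circuit_fn (@swap_ord m n)) (circuit_fn (@id 'I_p))))
      (hcast erefl (addnA n p m)
        (circuit_tens (circuit_fn (@id 'I_n)) (circuit_fn (@swap_ord m p))))).
Proof.
apply: circuit_eq_sym.
have C := cong_comp circuit_congruence.
apply: circuit_eq_trans.
  apply: C; apply: circuit_cast_eq; exact: circuit_tens_fn.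
rewrite !circuit_cast_fn; apply: circuit_comp_fn => x.
rewrite !cast_ord_id !esymK.
rewrite split_addnA {3}/swap_ord.
have cl e (y : 'I_n) : cast_ord e (lshift (m + p) y) = lshift p (lshift m y).
  exact: val_inj.
have cm e (y : 'I_m) : cast_ord e (rshift n (lshift p y)) = lshift p (rshift n y).
  exact: val_inj.
have cr e (y : 'I_p) : cast_ord e (rshift n (rshift m y)) = rshift (n + m) y.
  by apply: val_inj; rewrite /= addnA.
case: (split_ordP x) => [y|i] _ /=.
  case: (split_ordP y) => [j|k] -> /=.
    by rewrite cl split_l /= /swap_ord split_l; apply: val_inj.
  by rewrite /swap_ord split_l cr split_r; apply: val_inj; rewrite /= addnA.
by rewrite /swap_ord split_r cm split_l /= split_r; apply: val_inj.
Qed.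

End CircuitLaws.

Lemma circuit_laws L : prop_laws (circuit_ops L) (@circuit_eq L).
Proof.
split.
- exact: circuit_compA.
- move=> m n c.
  exact: (circuit_comp_fnl c (s := id) (s' := id) (fun=> erefl) (fun=> erefl)).
- move=> m n c; exact: (circuit_comp_fnr c id).
- move=> m n; apply: circuit_eq_trans (circuit_tens_fn _ _ _) _.
  apply: circuit_ext => //= x.
  by rewrite -[RHS]splitK; case: (split x).
- exact: circuit_tens_comp.
- exact: circuit_tensA.
- exact: circuit_tens0l.
- exact: circuit_tens0r.
- exact: circuit_braid_nat.
- move=> m n; apply: circuit_comp_fn; exact: swap_ordK.
- exact: circuit_hexagon.
Qed.

(* Morphisms m -> n are isomorphism classes of L-circuits from 'I_m to 'I_n. *)
Definition Circ (L : Type) : prop :=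
  quot_prop (circuit_congruence L) (circuit_laws L).

Section CospanLaws.

(* The prop axioms for cospans are those for circuits without edges. *)
Let J m n (c : cospan m n) : hom (Circ void) m n :=
  cls _ (circuit_of_cospan void c).

Let JE m n (c d : cospan m n) : cospan_eq c d <-> J c = J d.
Proof.
rewrite /J (cls_eqP (circuit_eq_equiv void m n)).
split=> [[h hP]|[h [k [hP _ _ _ _]]]]; last by exists h.
by exists h, id; split=> //; exists id.
Qed.

Let J_comp m n p (c : cospan m n) (d : cospan n p) :
  J (ocomp cospan_ops c d) = ocomp (hops (Circ void)) (J c) (J d).
Proof.
symmetry; apply: (etrans (quot_comp (circuit_congruence void) _ _)).
apply/(cls_eqP (circuit_eq_equiv void m p)).
exists id, (sum_case id id); split=> /=; try by do ?case.
- by split=> //; exists id.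
- by exists inl; do ?case.
Qed.

Let J_tens m n m' n' (c : cospan m n) (d : cospan m' n') :
  J (otens cospan_ops c d) = otens (hops (Circ void)) (J c) (J d).
Proof.
symmetry; apply: (etrans (quot_tens (circuit_congruence void) _ _)).
apply/(cls_eqP (circuit_eq_equiv void _ _)).
exists id, (sum_case id id); split=> /=; try by do ?case.
- by split=> //; exists id.
- by exists inl; do ?case.
Qed.

Lemma cospan_congruence : congruence cospan_ops cospan_eq.
Proof. exact: (pullback_congruence JE J_comp J_tens). Qed.

Lemma cospan_laws : prop_laws cospan_ops cospan_eq.
Proof. exact: (pullback_laws JE _ J_comp J_tens). Qed.

End CospanLaws.

(* Morphisms m -> n are isomorphism classes of cospans 'I_m -> N <- 'I_n. *)
Definition FinCospan : prop := quot_prop cospan_congruence cospan_laws.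

(* Main.v *)
From mathcomp Require Import all_boot.
From mathcomp Require Import boolp.
Require Import Defs.

Set Implicit Arguments.
Unset Strict Implicit.
Unset Printing Implicit Defensive.

(** Let D be a prop with a morphism F from FinCospan and an endomorphism G l of
    the object 1 for each label l, that is, a morphism from the free prop on the
    labels.  In FinCospan the object 1 is self-dual, so an l-edge 1 -> 1 can be
    bent into a state [arc l : 0 -> 2], whose two outputs are the target and the
    source of the edge.  A circuit m -> n with node set N, legs i, o and edges
    e_1, ..., e_k is then built in D by creating the arcs of all the edges next to
    the m inputs, and feeding everything to one cospan with apex N, which
    identifies each loose end with the node it belongs to:

      circuit = (arc l_1 (x) id) ; ... ; (arc l_k (x) id) ;
                F ('I_(2k + m) -> N <- 'I_n).

    This expression, computed by recursion on the list of edges, is [interp].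
    Prefixing one arc at a time keeps the types simple, and the whole proof rests
    on a few facts on [interp].

    - States slide past any morphism ([state_slide]), so two consecutive arcs can
      be exchanged up to a permutation, which the final cospan absorbs
      ([interp_swap]).  Hence the value does not depend on the enumeration of the
      edges ([interp_perm]), and it is an invariant of circuits ([circ_eval_eq]).
    - A cospan in front of a circuit slides past its arcs and merges with its
      cospan by a pushout ([struct_interp]); by induction, composites of circuits
      go to composites ([circ_eval_comp]).
    - Tensoring with an identity on the right is equally direct
      ([circ_eval_tensr]), and every tensor product is expressed by such tensors,
      composition and braiding ([ptens_split]), which gives [circ_eval_tens].
    - A zigzag identity in FinCospan unbends the arc of a single edge
      ([snake], [circ_eval_edge]), so the morphism extends G as well as F.
    - In the prop of circuits itself, a circuit is the value of its own expression
      ([circ_eval_circ]).  As morphisms of props commute with [interp]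
      ([interp_natural]), a morphism out of the prop of circuits is determined by
      its restrictions to cospans and to edges. *)

(** * Morphisms out of a quotient prop *)

Section QuotMorphism.
Variables (H : nat -> nat -> Type) (o : prop_ops H).
Variable E : forall m n, H m n -> H m n -> Prop.
Hypotheses (cE : congruence o E) (lE : prop_laws o E).
Variables (Q : prop) (J : forall m n, H m n -> hom Q m n).
Hypothesis J_eq : forall m n (f g : H m n), E f g -> J f = J g.
Hypothesis J_id : forall n, J (oid o n) = pid Q n.
Hypothesis J_comp : forall m n p (f : H m n) (g : H n p),
  J (ocomp o f g) = pcomp (J f) (J g).
Hypothesis J_tens : forall m n m' n' (f : H m n) (g : H m' n'),
  J (otens o f g) = ptens (J f) (J g).
Hypothesis J_braid : forall m n, J (obraid o m n) = pbraid Q m n.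

Lemma quot_lift_cls m n (f : H m n) : J (repr (cls (@E m n) f)) = J f.
Proof. exact/J_eq/(repr_cls cE). Qed.

Definition quot_lift (m n : nat) (f : hom (quot_prop cE lE) m n) : hom Q m n :=
  J (repr f).

Lemma quot_lift_comp m n p (f : hom (quot_prop cE lE) m n)
    (g : hom (quot_prop cE lE) n p) :
  quot_lift (pcomp f g) = pcomp (quot_lift f) (quot_lift g).
Proof. by rewrite /quot_lift quot_lift_cls J_comp. Qed.

Lemma quot_lift_tens m n m' n' (f : hom (quot_prop cE lE) m n)
    (g : hom (quot_prop cE lE) m' n') :
  quot_lift (ptens f g) = ptens (quot_lift f) (quot_lift g).
Proof. by rewrite /quot_lift quot_lift_cls J_tens. Qed.

Definition quot_morphism : morphism (quot_prop cE lE) Q :=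
  Morphism (fun n => etrans (quot_lift_cls (oid o n)) (J_id n))
    quot_lift_comp quot_lift_tens
    (fun m n => etrans (quot_lift_cls (obraid o m n)) (J_braid m n)).

Lemma quot_morphism_cls m n (f : H m n) : mfun quot_morphism (cls _ f) = J f.
Proof. exact: quot_lift_cls. Qed.

End QuotMorphism.

(** * Calculus in a prop *)

Lemma hcast_id (H : nat -> nat -> Type) m n (em : m = m) (en : n = n)
    (f : H m n) : hcast em en f = f.
Proof. by rewrite (eq_irrelevance em erefl) (eq_irrelevance en erefl). Qed.

Section PropCalculus.
Variable P : prop.

Lemma pcompA m n p q (f : hom P m n) (g : hom P n p) (h : hom P p q) :
  pcomp f (pcomp g h) = pcomp (pcomp f g) h.
Proof. exact: (law_compA (hlaws P)). Qed.

Lemma pcomp1l m n (f : hom P m n) : pcomp (pid P m) f = f.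
Proof. exact: (law_idl (hlaws P)). Qed.

Lemma pcomp1r m n (f : hom P m n) : pcomp f (pid P n) = f.
Proof. exact: (law_idr (hlaws P)). Qed.

Lemma ptens1 m n : ptens (pid P m) (pid P n) = pid P (m + n).
Proof. exact: (law_tens_id (hlaws P)). Qed.

Lemma ptens_comp m n p m' n' p'
    (f : hom P m n) (g : hom P n p) (f' : hom P m' n') (g' : hom P n' p') :
  ptens (pcomp f g) (pcomp f' g') = pcomp (ptens f f') (ptens g g').
Proof. exact: (law_tens_comp (hlaws P)). Qed.

Lemma ptens0l m n (f : hom P m n) : ptens (pid P 0) f = f.
Proof.
have := law_tens0l (hlaws P) f.
by rewrite (hcast_id (add0n m) (add0n n)).
Qed.

(** When the first arity is a numeral, [k + (m + p)] and [k + m + p] are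
    convertible, and [erefl] can be given for [em] and [en]: the transport
    disappears. *)
Lemma ptensA_id k l m n p q (f : hom P k l) (g : hom P m n) (h : hom P p q)
    (em : k + (m + p) = k + m + p) (en : l + (n + q) = l + n + q) :
  hcast em en (ptens f (ptens g h)) = ptens (ptens f g) h.
Proof.
rewrite (eq_irrelevance em (addnA k m p)) (eq_irrelevance en (addnA l n q)).
exact: (law_tensA (hlaws P)).
Qed.

Lemma state_pid (x : hom P 0 2) m p :
  ptens x (pid P (m + p)) =
    ptens (ptens x (pid P m)) (pid P p) :> hom P (m + p) (2 + m + p).
Proof.
rewrite -ptens1.
exact: (@ptensA_id 0 2 m m p p x (pid P m) (pid P p) erefl erefl).
Qed.

Lemma pbraid_nat m n m' n' (f : hom P m n) (g : hom P m' n') :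
  pcomp (ptens f g) (pbraid P n n') = pcomp (pbraid P m m') (ptens g f).
Proof. exact: (law_braid_nat (hlaws P)). Qed.

Lemma pbraidK m n : pcomp (pbraid P m n) (pbraid P n m) = pid P (m + n).
Proof. exact: (law_braidK (hlaws P)). Qed.

(** Naturality of the braiding turns a tensor by an identity on the left into one
    on the right, so that compatibility with tensor products need only be checked
    against identities on the right. *)
Lemma ptens_split m n m' n' (f : hom P m n) (g : hom P m' n') :
  ptens f g =
    pcomp (ptens f (pid P m'))
      (pcomp (pbraid P n m') (pcomp (ptens g (pid P n)) (pbraid P n' n))).
Proof.
rewrite [pcomp (pbraid _ _ _) _]pcompA -pbraid_nat -pcompA pbraidK pcomp1r.
by rewrite -ptens_comp pcomp1l pcomp1r.
Qed.

(** A state has no input, hence it can be created before or after anything else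
    happens; [n] stands for [0 + n], to which it is convertible. *)
Lemma state_slide k (x : hom P 0 k) m n (f : hom P m n) :
  pcomp f (ptens x (pid P n) : hom P n (k + n)) =
    pcomp (ptens x (pid P m) : hom P m (k + m)) (ptens (pid P k) f).
Proof.
have := ptens_comp (pid P 0) x f (pid P n).
rewrite pcomp1l pcomp1r ptens0l => <-.
by have := ptens_comp x (pid P k) (pid P m) f; rewrite pcomp1l pcomp1r.
Qed.

End PropCalculus.

(** * Pushout squares of cospans *)

(** Recognising pushouts by their universal property, with uniqueness expressed
    as joint surjectivity, makes composites of cospans computable with a
    convenient apex instead of the chosen quotient. *)
Definition is_pushout (Y A B P : finType) (f : Y -> A) (g : Y -> B)
    (a : A -> P) (b : B -> P) : Prop :=
  [/\ forall y, a (f y) = b (g y),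
      forall z, (exists x, z = a x) \/ (exists y, z = b y)
    & forall (T : Type) (u : A -> T) (v : B -> T),
        (forall y, u (f y) = v (g y)) ->
      exists w : P -> T, (forall x, w (a x) = u x) /\ (forall y, w (b y) = v y)].

Lemma pushout_is_pushout (Y A B : finType) (f : Y -> A) (g : Y -> B) :
  is_pushout f g (fun x => po_in f g (inl x)) (fun y => po_in f g (inr y)).
Proof.
split; first exact: po_glue.
- by elim/po_ind=> -[x|y]; [left; exists x | right; exists y].
- by move=> T u v uv; exists (po_desc u v); split=> x; rewrite po_descE.
Qed.

Lemma cospan_comp_pushout m n p (c : cospan m n) (d : cospan n p) (P : finType)
    (a : apex c -> P) (b : apex d -> P) :
  is_pushout (rleg c) (lleg d) a b ->
  cospan_eq (cospan_comp c d) (Cospan (a \o lleg c) (b \o rleg d)).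
Proof.
case=> ab surj univ; exists (po_desc a b); split=> [|x|y]; rewrite ?po_descE //.
have [w [wa wb]] := univ _ (fun x => po_in _ _ (inl x))
  (fun y => po_in _ _ (inr y)) (po_glue (rleg c) (lleg d)).
exists w; first by elim/po_ind=> -[x|y]; rewrite po_descE /=.
by move=> z; case: (surj z) => -[x ->]; rewrite ?wa ?wb po_descE.
Qed.

Definition copair a b (T : Type) (p : 'I_a -> T) (i : 'I_b -> T)
    (x : 'I_(a + b)) : T := sum_case p i (split x).

Lemma copair_comp a b (T U : Type) (h : T -> U) (p : 'I_a -> T) (i : 'I_b -> T) :
  h \o copair p i = copair (h \o p) (h \o i).
Proof. by apply/funext => x; rewrite /copair /=; case: (split x). Qed.

(** Typable without transport because [2 + (b + c)] and [2 + b + c] are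
    convertible. *)
Lemma copairA b c (T : Type) (p : 'I_2 -> T) (q : 'I_b -> T) (r : 'I_c -> T) :
  copair p (copair q r) = copair (copair p q) r.
Proof.
apply/funext => x; have := split_addnA (esym (addnA 2 b c)) x.
rewrite cast_ord_id /copair => ->.
case: (@split (2 + b) c x) => [y|k] /=; last by rewrite split_r.
by case: (split y) => [j|j] //=; rewrite split_l.
Qed.

(** If a cospan is widened by [k] wires which pass through it and then end at the
    nodes [p] of the next cospan, the composite keeps the apex [P]: the new wires
    add no node to it.  This drives the induction of [struct_interp]. *)
Lemma pushout_extend k n (A B P : finType) (f : 'I_n -> A) (g : 'I_n -> B)
    (a : A -> P) (b : B -> P) (p : 'I_k -> B) :
  is_pushout f g a b ->
  is_pushout (fun x => sum_map (@id 'I_k) f (split x)) (copair p g)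
    (sum_case (b \o p) a) b.
Proof.
case=> ab surj univ; split.
- by move=> y; rewrite /copair; case: (split y) => //= z; rewrite ab.
- move=> z; case: (surj z) => -[x ->]; last by right; exists x.
  by left; exists (inr x).
- move=> T u v uv.
  have uvr y : u (inr (f y)) = v (g y).
    by have := uv (rshift k y); rewrite /copair split_r.
  have uvl j : u (inl j) = v (p j).
    by have := uv (lshift n j); rewrite /copair split_l.
  have [w [wa wb]] := univ _ (u \o inr) v uvr; exists w; split=> // -[j|x] //=.
  by rewrite wb uvl.
Qed.

Lemma pushout_along_surj (Y A B : finType) (f : Y -> A) (g : Y -> B)
    (a : A -> B) :
  (forall x, exists y, f y = x) -> (forall y, a (f y) = g y) ->
  is_pushout f g a id.
Proof.
move=> sf ag; split=> [y|z|T u v uv]; [exact: ag | by right; exists z |].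
by exists v; split=> // x; have [y <-] := sf x; rewrite ag uv.
Qed.

(** * The prop of circuits *)

Section CircClass.
Variable L : Type.

Definition circ_cls m n (c : circuit L m n) : hom (Circ L) m n := cls _ c.

Lemma circ_cls_comp m n p (c : circuit L m n) (d : circuit L n p) :
  pcomp (circ_cls c) (circ_cls d) = circ_cls (circuit_comp c d).
Proof. exact: (quot_comp (circuit_congruence L)). Qed.

Lemma circ_cls_tens m n m' n' (c : circuit L m n) (d : circuit L m' n') :
  ptens (circ_cls c) (circ_cls d) = circ_cls (circuit_tens c d).
Proof. exact: (quot_tens (circuit_congruence L)). Qed.

Lemma circ_cls_id n : pid (Circ L) n = circ_cls (circuit_fn L (@id 'I_n)).
Proof. by []. Qed.

Lemma circ_cls_braid m n :
  pbraid (Circ L) m n = circ_cls (circuit_fn L (@swap_ord m n)).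
Proof. by []. Qed.

Lemma circ_clsP m n (c d : circuit L m n) :
  circ_cls c = circ_cls d <-> circuit_eq c d.
Proof. exact: (cls_eqP (circuit_eq_equiv L m n)). Qed.

End CircClass.

(** * Interpreting circuits in a prop *)

Lemma eq_map_square (A B C T : Type) (f : A -> B) (g : B -> T) (h : A -> C)
    (k : C -> T) (s : seq A) :
  (forall x, g (f x) = k (h x)) -> map g (map f s) = map k (map h s).
Proof. by move=> fghk; elim: s => //= x s ->; rewrite fghk. Qed.

Section Interp.
Variables (L : Type) (D : prop).
Variables (F : morphism FinCospan D) (G : L -> hom D 1 1).

Definition struct m n (c : cospan m n) : hom D m n := mfun F (cls _ c).

Lemma struct_eq m n (c d : cospan m n) : cospan_eq c d -> struct c = struct d.
Proof.
move=> cd; congr (mfun F _).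
exact/(cls_eqP (cong_equiv cospan_congruence m n)).
Qed.

Lemma struct_id n : struct (cospan_fn (@id 'I_n)) = pid D n.
Proof. exact: (mfun_id F). Qed.

Lemma struct_braid m n : struct (cospan_fn (@swap_ord m n)) = pbraid D m n.
Proof. exact: (mfun_braid F). Qed.

Lemma struct_tens m n m' n' (c : cospan m n) (d : cospan m' n') :
  ptens (struct c) (struct d) = struct (cospan_tens c d).
Proof.
rewrite /struct -(mfun_tens F); congr (mfun F _).
exact: (quot_tens cospan_congruence).
Qed.

Lemma struct_comp m n p (c : cospan m n) (d : cospan n p) (P : finType)
    (a : apex c -> P) (b : apex d -> P) :
  is_pushout (rleg c) (lleg d) a b ->
  pcomp (struct c) (struct d) = struct (Cospan (a \o lleg c) (b \o rleg d)).
Proof.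
move=> po; rewrite /struct -(mfun_comp F).
rewrite [pcomp _ _](quot_comp cospan_congruence).
exact/struct_eq/cospan_comp_pushout.
Qed.

Definition unit_cospan : cospan 0 2 :=
  @Cospan 0 2 'I_1 (fun _ => ord0) (fun _ => ord0).

(** The first output is the target of the edge, the second one its source. *)
Definition arc (l : L) : hom D 0 2 :=
  pcomp (struct unit_cospan) (ptens (G l) (pid D 1) : hom D 2 2).

(** An edge on the node set [N]: its label, and its target and source listed in
    the order of the outputs of [arc]. *)
Definition arrow (N : Type) : Type := L * ('I_2 -> N).

Definition arrow_map (N N' : Type) (h : N -> N') (e : arrow N) : arrow N' :=
  (e.1, h \o e.2).

(** The two loose ends of each new arc become inputs of the rest of the circuit,
    and the node they are attached to is recorded in the left leg. *)
Fixpoint interp (N : finType) (es : seq (arrow N)) m n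
    (i : 'I_m -> N) (o : 'I_n -> N) : hom D m n :=
  match es with
  | [::] => struct (Cospan i o)
  | e :: es' => pcomp (ptens (arc e.1) (pid D m) : hom D m (2 + m))
                  (interp es' (copair e.2 i) o)
  end.

Lemma interp_ext (N : finType) (es es' : seq (arrow N)) m n
    (i i' : 'I_m -> N) (o o' : 'I_n -> N) :
  es = es' -> i =1 i' -> o =1 o' -> interp es i o = interp es' i' o'.
Proof. by move=> -> /funext-> /funext->. Qed.

(** The front cospan slides past the first arc, which widens it by two wires; as
    the apex of the composite is unchanged by this ([pushout_extend]), the
    induction goes through with a fixed [P]. *)
Lemma struct_interp (N N' P : finType) (es : seq (arrow N')) m n p
    (i : 'I_m -> N) (o : 'I_n -> N) (i' : 'I_n -> N') (o' : 'I_p -> N')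
    (a : N -> P) (b : N' -> P) :
  is_pushout o i' a b ->
  pcomp (struct (Cospan i o)) (interp es i' o') =
    interp (map (arrow_map b) es) (a \o i) (b \o o').
Proof.
elim: es N a m n i o i' => [|e es IH] N a m n i o i' po /=.
  exact: (@struct_comp _ _ _ (Cospan i o) (Cospan i' o') P).
rewrite pcompA state_slide -pcompA; congr pcomp.
rewrite -struct_id struct_tens.
have := pushout_extend e.2 po => {}po; rewrite [LHS](IH _ _ _ _ _ _ _ po).
congr interp; apply/funext => x /=.
by rewrite /copair /=; case: (split x).
Qed.

Lemma interp_comp (N N' P : finType) (es : seq (arrow N)) (es' : seq (arrow N'))
    m n p (i : 'I_m -> N) (o : 'I_n -> N) (i' : 'I_n -> N') (o' : 'I_p -> N')
    (a : N -> P) (b : N' -> P) :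
  is_pushout o i' a b ->
  pcomp (interp es i o) (interp es' i' o') =
    interp (map (arrow_map a) es ++ map (arrow_map b) es') (a \o i) (b \o o').
Proof.
move=> po; elim: es m i => [|e es IH] m i /=; first exact: struct_interp.
by rewrite -pcompA IH copair_comp.
Qed.

Lemma interp_iso (N N' : finType) (h : N -> N') (es : seq (arrow N)) m n
    (i : 'I_m -> N) (o : 'I_n -> N) :
  bijective h -> interp (map (arrow_map h) es) (h \o i) (h \o o) = interp es i o.
Proof.
move=> bh; elim: es m i => [|e es IH] m i /=; last by rewrite -copair_comp IH.
by apply/esym/struct_eq; exists h.
Qed.

(** By naturality of the braiding, creating two states in the other order only
    permutes their outputs.  The braiding of the empty bundle of inputs with two
    wires is an identity, because it is the image of an identity cospan. *)
Lemma state_swap (x y : hom D 0 2) m :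
  pcomp (ptens x (pid D m) : hom D m (2 + m))
        (ptens y (pid D (2 + m)) : hom D (2 + m) (2 + (2 + m))) =
  pcomp (pcomp (ptens y (pid D m) : hom D m (2 + m))
               (ptens x (pid D (2 + m)) : hom D (2 + m) (2 + (2 + m))))
        (ptens (pbraid D 2 2) (pid D m)).
Proof.
have braid02 : pbraid D 0 2 = pid D 2.
  rewrite -struct_braid -struct_id; congr struct; congr cospan_fn.
  apply/funext => j; apply: val_inj; rewrite /swap_ord.
  by case: (@split_ordP 2 0 j) => [k|[]//] -> /=.
have swap_x : ptens (pid D 2) x =
    pcomp (ptens x (pid D 2) : hom D 2 4) (pbraid D 2 2).
  by have := pbraid_nat x (pid D 2); rewrite braid02 => ->; rewrite pcomp1l.
rewrite state_slide -pcompA; congr pcomp.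
rewrite [LHS](@ptensA_id D 2 2 0 2 m m _ _ _ erefl erefl).
rewrite (state_pid x 2 m) swap_x.
have := ptens_comp (ptens x (pid D 2)) (pbraid D 2 2) (pid D m) (pid D m).
by rewrite pcomp1l.
Qed.

(** The permutation left over by [state_swap] only relabels the left leg of the
    final cospan. *)
Lemma interp_swap (N : finType) (d e : arrow N) (es : seq (arrow N)) m n
    (i : 'I_m -> N) (o : 'I_n -> N) :
  interp (d :: e :: es) i o = interp (e :: d :: es) i o.
Proof.
rewrite /= !pcompA state_swap -[LHS]pcompA; congr pcomp.
rewrite -struct_braid -struct_id struct_tens.
set c := cospan_tens _ _.
have po : is_pushout (rleg c) (copair e.2 (copair d.2 i))
    (sum_case (copair d.2 e.2) i) id.
  apply: pushout_along_surj => [x|y].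
    case: x => [x|x]; [exists (lshift m (swap_ord x)) | exists (rshift 4 x)].
      by rewrite /= split_l /= swap_ordK.
    by rewrite /= split_r.
  rewrite copairA /copair /=; case: (@split (2 + 2) m y) => //= z.
  by rewrite /swap_ord; case: (split z) => w; rewrite ?split_l ?split_r.
have c_i : sum_case (copair d.2 e.2) i \o lleg c = copair d.2 (copair e.2 i).
  rewrite copairA; apply/funext => x; rewrite /copair /=.
  by case: (@split (2 + 2) m x).
have es_id : map (arrow_map id) es = es.
  by rewrite -[RHS]map_id; apply: eq_map => -[l q].
by have := struct_interp es (lleg c) o po; rewrite c_i es_id.
Qed.

Lemma interp_move (N : finType) (e : arrow N) (es es' : seq (arrow N)) m n
    (i : 'I_m -> N) (o : 'I_n -> N) :
  interp (es ++ e :: es') i o = interp (e :: es ++ es') i o.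
Proof.
elim: es m i => [|d es IH] m i //.
by rewrite -[RHS]interp_swap [LHS]/= IH.
Qed.

Lemma interp_perm (N : finType) (E : eqType) (f : E -> arrow N) (xs ys : seq E)
    m n (i : 'I_m -> N) (o : 'I_n -> N) :
  perm_eq xs ys -> interp (map f xs) i o = interp (map f ys) i o.
Proof.
elim: xs ys m i => [|x xs IH] ys m i xsys.
  by rewrite (perm_nilP (etrans (perm_sym _ _) xsys)).
have /path.splitPr ys_x : x \in ys by rewrite -(perm_mem xsys) mem_head.
case: ys_x xsys => ys1 ys2.
rewrite perm_sym -cat1s perm_catCA perm_cons perm_sym => xsys.
by rewrite map_cat [RHS]interp_move -map_cat /= (IH (ys1 ++ ys2)).
Qed.

Lemma interp_tensr (N : finType) (es : seq (arrow N)) m n p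
    (i : 'I_m -> N) (o : 'I_n -> N) :
  ptens (interp es i o) (pid D p) =
    interp (map (arrow_map inl) es) (copair (inl \o i) inr)
      (copair (inl \o o) (@inr N 'I_p)).
Proof.
elim: es m i => [|e es IH] m i.
  rewrite /= -struct_id struct_tens; congr struct; congr Cospan;
  by apply/funext => x; rewrite /copair /=; case: (split x).
rewrite /= copairA -copair_comp.
rewrite -[interp (map (arrow_map inl) es) _ _](IH _ (copair e.2 i)).
rewrite state_pid.
have := ptens_comp (ptens (arc e.1) (pid D m)) (interp es (copair e.2 i) o)
  (pid D p) (pid D p).
by rewrite pcomp1l.
Qed.

Definition endpoints m n (c : circuit L m n) (e : edge c) : arrow (apex c) :=
  (lab c e, fun j : 'I_2 => if j == ord0 then tgt c e else src c e).

Definition circ_eval m n (c : circuit L m n) : hom D m n :=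
  interp (map (@endpoints m n c) (enum (edge c))) (lleg c) (rleg c).

Lemma circ_eval_perm m n (c : circuit L m n) (es : seq (edge c)) :
  uniq es -> es =i edge c ->
  circ_eval c = interp (map (@endpoints m n c) es) (lleg c) (rleg c).
Proof.
move=> ues es_all; apply/interp_perm/uniq_perm; rewrite ?enum_uniq // => e.
by rewrite mem_enum es_all.
Qed.

Lemma circ_eval_eq m n (c d : circuit L m n) :
  circuit_eq c d -> circ_eval c = circ_eval d.
Proof.
move=> [h [k [[bh hl hr] bk ks kt kl]]].
have [k' kK Kk] := bk.
rewrite (@circ_eval_perm _ _ d (map k (enum (edge c)))).
- rewrite /circ_eval -(interp_iso _ _ _ bh).
  apply: interp_ext => //; apply: eq_map_square => e.
  rewrite /arrow_map /endpoints /= kl; congr pair.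
  by apply/funext => j /=; case: ifP; rewrite ?ks ?kt.
- by rewrite map_inj_uniq ?enum_uniq //; apply: bij_inj.
- by move=> e; rewrite -(Kk e) mem_map ?mem_enum //; apply: bij_inj.
Qed.

Lemma circ_eval_comp m n p (c : circuit L m n) (d : circuit L n p) :
  circ_eval (circuit_comp c d) = pcomp (circ_eval c) (circ_eval d).
Proof.
rewrite (interp_comp _ _ _ _ (pushout_is_pushout (rleg c) (lleg d))).
rewrite (@circ_eval_perm _ _ (circuit_comp c d)
  (map inl (enum (edge c)) ++ map inr (enum (edge d)))).
- rewrite map_cat; apply: interp_ext => //.
  by congr (_ ++ _); apply: eq_map_square => e; congr pair; apply/funext => j /=;
    case: ifP.
- rewrite cat_uniq; apply/and3P; split.
  + by rewrite map_inj_uniq ?enum_uniq // => ? ? [].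
  + by apply/hasPn => _ /mapP[e _ ->]; apply/mapP => -[].
  + by rewrite map_inj_uniq ?enum_uniq // => ? ? [].
- by move=> [] e; rewrite mem_cat; apply/orP; [left|right]; apply/map_f;
    rewrite mem_enum.
Qed.

Lemma circ_eval_cospan m n (c : cospan m n) :
  circ_eval (circuit_of_cospan L c) = struct c.
Proof.
rewrite (@circ_eval_perm _ _ (circuit_of_cospan L c) [::]) //=.
by case: c.
Qed.

Lemma circ_eval_tensr m n (c : circuit L m n) p :
  circ_eval (circuit_tens c (circuit_fn L (@id 'I_p))) =
    ptens (circ_eval c) (pid D p).
Proof.
rewrite interp_tensr.
rewrite (@circ_eval_perm _ _ (circuit_tens c (circuit_fn L (@id 'I_p)))
  (map inl (enum (edge c)))).
- apply: interp_ext => [|x|x].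
  + by apply: eq_map_square => e; congr pair; apply/funext => j /=; case: ifP.
  + by rewrite /copair /=; case: (split x).
  + by rewrite /copair /=; case: (split x).
- by rewrite map_inj_uniq ?enum_uniq // => ? ? [].
- by case=> // e; apply/map_f; rewrite mem_enum.
Qed.

(** The decomposition of [ptens_split] holds in the prop of circuits too, where
    it identifies the tensor product with a composite of circuits whose values
    are already known. *)
Lemma circ_eval_tens m n m' n' (c : circuit L m n) (d : circuit L m' n') :
  circ_eval (circuit_tens c d) = ptens (circ_eval c) (circ_eval d).
Proof.
rewrite ptens_split -!circ_eval_tensr -!struct_braid -!circ_eval_cospan.
rewrite -!circ_eval_comp; apply: circ_eval_eq.
apply/circ_clsP; have := ptens_split (circ_cls c) (circ_cls d).
by rewrite !circ_cls_braid !circ_cls_id !circ_cls_tens !circ_cls_comp.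
Qed.

Definition circ_morphism : morphism (Circ L) D :=
  quot_morphism (circuit_congruence L) (circuit_laws L) circ_eval_eq
    (fun n => etrans (circ_eval_cospan _) (struct_id n)) circ_eval_comp
    circ_eval_tens (fun m n => etrans (circ_eval_cospan _) (struct_braid m n)).

Lemma circ_morphismE m n (c : circuit L m n) :
  mfun circ_morphism (circ_cls c) = circ_eval c.
Proof. exact: quot_morphism_cls. Qed.

End Interp.

(** * A single edge *)

(** The target is the first summand, so that the nodes are those of the identity
    of 1 tensored with [counit_cospan] in [circ_eval_edge]. *)
Definition edge_circuit (L : Type) (l : L) : circuit L 1 1 :=
  @Circuit L 1 1 (@Cospan 1 1 ('I_1 + 'I_1)%type
     (fun _ => inr ord0) (fun _ => inl ord0))
    (@LGraph L _ unit (fun _ => inr ord0) (fun _ => inl ord0) (fun _ => l)).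

Section Edge.
Variables (L : Type) (D : prop).
Variables (F : morphism FinCospan D) (G : L -> hom D 1 1).

Definition counit_cospan : cospan 2 0 :=
  @Cospan 2 0 'I_1 (fun _ => ord0) (fun _ => ord0).

(** The zigzag identity for the self-dual object 1: all four nodes of the
    composite are glued together. *)
Lemma snake :
  pcomp (ptens (struct F unit_cospan) (pid D 1) : hom D 1 3)
        (ptens (pid D 1) (struct F counit_cospan) : hom D 3 1) = pid D 1.
Proof.
pose c := cospan_tens unit_cospan (cospan_fn (@id 'I_1)).
pose d := cospan_tens (cospan_fn (@id 'I_1)) counit_cospan.
have po : @is_pushout _ _ _ 'I_1 (rleg c) (lleg d)
    (fun _ => ord0) (fun _ => ord0).
  split=> [//|z|T u v uv]; first by left; exists (inl ord0); rewrite ord1.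
  (* The three points of the middle boundary link the four nodes in a path. *)
  have uv0 : u (inl ord0) = v (inl ord0).
    have := uv (@Ordinal 3 0 erefl); rewrite /= /split.
    by do 2!(case: ltnP => // ?); rewrite /= !ord1.
  have uv1 : u (inl ord0) = v (inr ord0).
    have := uv (@Ordinal 3 1 erefl); rewrite /= /split.
    by do 2!(case: ltnP => // ?); rewrite /= !ord1.
  have uv2 : u (inr ord0) = v (inr ord0).
    have := uv (@Ordinal 3 2 erefl); rewrite /= /split.
    by do 2!(case: ltnP => // ?); rewrite /= !ord1.
  exists (fun _ => u (inl ord0)); split=> -[] x; rewrite (ord1 x) //.
  by rewrite uv1 uv2.
rewrite -!(struct_id F) !struct_tens [LHS](struct_comp F po).
by apply: struct_eq; exists id; split=> [|x|x] /=; rewrite ?ord1 //; exists id.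
Qed.

(** The target of the arc is the output and its source is joined to the input:
    [G l] slides past the counit that joins them, and the bent wire that remains
    is straightened by [snake]. *)
Lemma circ_eval_edge (l : L) : circ_eval F G (edge_circuit l) = G l.
Proof.
rewrite (@circ_eval_perm _ _ F G _ _ (edge_circuit l) [:: tt]) //=.
set i := copair _ _.
have -> : struct F (Cospan i (fun _ => inl ord0)) =
    ptens (pid D 1) (struct F counit_cospan).
  rewrite -(struct_id F) struct_tens; apply: struct_eq; exists id.
  split=> [|x|x]; first by exists id.
    case: x => -[|[|[|//]]] h; rewrite /i /copair /= /split;
      by do 2!(case: ltnP => // ?); rewrite /= ?ord1.
  by rewrite /= /split; case: ltnP => [?|]; rewrite /= ?ord1 //; case: x.
(* The arities are numerals, so reassociating needs no transport. *)
have GA : ptens (ptens (G l) (pid D 1)) (pid D 1) = ptens (G l) (pid D 2).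
  rewrite -(ptens1 D 1 1).
  by rewrite [RHS](@ptensA_id D 1 1 1 1 1 1 _ _ _ erefl erefl).
have arcl : ptens (arc F G l) (pid D 1) =
    pcomp (ptens (struct F unit_cospan) (pid D 1) : hom D 1 3)
          (ptens (G l) (pid D 2)).
  rewrite -GA.
  have := ptens_comp (struct F unit_cospan) (ptens (G l) (pid D 1))
            (pid D 1) (pid D 1).
  by rewrite pcomp1l.
rewrite arcl -pcompA.
have -> : pcomp (ptens (G l) (pid D 2))
                (ptens (pid D 1) (struct F counit_cospan)) =
    pcomp (ptens (pid D 1) (struct F counit_cospan)) (ptens (G l) (pid D 0)).
  by rewrite -!ptens_comp !pcomp1l !pcomp1r.
rewrite pcompA snake pcomp1l; have := law_tens0r (hlaws D) (G l).
by rewrite (hcast_id (addn0 1) (addn0 1)).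
Qed.

End Edge.

(** * The two inclusions *)

Section Inclusions.
Variable L : Type.

Lemma circuit_of_cospan_comp m n p (c : cospan m n) (d : cospan n p) :
  circ_cls (circuit_of_cospan L (cospan_comp c d)) =
    pcomp (circ_cls (circuit_of_cospan L c)) (circ_cls (circuit_of_cospan L d)).
Proof.
rewrite circ_cls_comp; apply/circ_clsP.
exists id, (of_void _); split; try by case.
- by split=> //; exists id.
- by exists (sum_case id id); do ?case.
Qed.

Lemma circuit_of_cospan_tens m n m' n' (c : cospan m n) (d : cospan m' n') :
  circ_cls (circuit_of_cospan L (cospan_tens c d)) =
    ptens (circ_cls (circuit_of_cospan L c)) (circ_cls (circuit_of_cospan L d)).
Proof.
rewrite circ_cls_tens; apply/circ_clsP.
exists id, (of_void _); split; try by case.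
- by split=> //; exists id.
- by exists (sum_case id id); do ?case.
Qed.

Lemma circuit_of_cospan_eq m n (c d : cospan m n) : cospan_eq c d ->
  circ_cls (circuit_of_cospan L c) = circ_cls (circuit_of_cospan L d).
Proof.
case=> h hP; apply/circ_clsP; exists h, id; split=> //; try by case.
by exists id.
Qed.

Definition cospan_incl : morphism FinCospan (Circ L) :=
  quot_morphism cospan_congruence cospan_laws circuit_of_cospan_eq
    (fun n => erefl) circuit_of_cospan_comp circuit_of_cospan_tens
    (fun m n => erefl).

Lemma cospan_inclE m n (c : cospan m n) :
  mfun cospan_incl (cls _ c) = circ_cls (circuit_of_cospan L c).
Proof. exact: quot_morphism_cls. Qed.

Definition label_gen (l : L) : hom (FreeAction L) 1 1 :=
  free_gen (action_label l).

Lemma action_incl_exists : exists j : morphism (FreeAction L) (Circ L),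
  forall l, mfun j (label_gen l) = circ_cls (edge_circuit l).
Proof.
pose g m n (x : action_gen L m n) : hom (Circ L) m n :=
  match x with action_label l => circ_cls (edge_circuit l) end.
have [j [jg _]] := FreeProp_universal g.
by exists j => l; apply: jg.
Qed.

Lemma action_morphism_eq (D : prop) (H H' : morphism (FreeAction L) D) :
  (forall l, mfun H (label_gen l) = mfun H' (label_gen l)) -> H = H'.
Proof.
move=> HH'; have [K [_ K_uniq]] :=
  FreeProp_universal (fun m n (x : action_gen L m n) => mfun H (free_gen x)).
rewrite -(K_uniq H) // -(K_uniq H') // => m n [l]; exact/esym/HH'.
Qed.

(** * Circuits are generated by cospans and edges *)

Definition add_arrow (N : finType) (e : arrow L N) (g : lgraph L N) :
    lgraph L N :=
  @LGraph L N (unit + edge g)%type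
    (sum_case (fun _ => e.2 ord_max) (src g))
    (sum_case (fun _ => e.2 ord0) (tgt g))
    (sum_case (fun _ => e.1) (lab g)).

Fixpoint arrows_graph (N : finType) (es : seq (arrow L N)) : lgraph L N :=
  match es with
  | [::] => no_edges L N
  | e :: es' => add_arrow e (arrows_graph es')
  end.

Let edge_cls (l : L) := circ_cls (edge_circuit l).

(** The nodes are the two outputs: [ord0] is the target of the edge, [ord_max]
    its source. *)
Definition arc_circuit (l : L) : circuit L 0 2 :=
  @Circuit L 0 2 (@Cospan 0 2 'I_2 (fun x => widen_ord (leq0n 2) x) id)
    (@LGraph L _ unit (fun _ => ord_max) (fun _ => ord0) (fun _ => l)).

Lemma arc_circ (l : L) : arc cospan_incl edge_cls l = circ_cls (arc_circuit l).
Proof.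
rewrite /arc /struct cospan_inclE circ_cls_id circ_cls_tens.
rewrite [LHS]circ_cls_comp; apply/circ_clsP.
set c := circuit_of_cospan _ _; set d := circuit_tens _ _.
pose b : ('I_1 + 'I_1) + 'I_1 -> 'I_2 :=
  sum_case (sum_case (fun _ => ord0) (fun _ => ord_max)) (fun _ => ord_max).
pose g (x : 'I_2) : apex (circuit_comp c d) :=
  if x == ord0 then po_in _ _ (inr (inl (inl ord0))) else po_in _ _ (inl ord0).
have glue0 : po_in (rleg c) (lleg d) (inl ord0) =
    po_in _ _ (inr (inl (inr ord0))).
  have := po_glue (rleg c) (lleg d) (@lshift 1 1 ord0).
  by rewrite /= (@split_l 1 1).
have glue1 : po_in (rleg c) (lleg d) (inl ord0) =
    po_in _ _ (inr (inr ord0)).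
  have := po_glue (rleg c) (lleg d) (@rshift 1 1 ord0).
  by rewrite /= (@split_r 1 1).
apply: (@circuit_comp_eq _ _ _ _ c d (arc_circuit l) (fun _ => ord_max) b g
  (sum_case (fun=> tt) (fun=> tt))) => //=.
- by move=> y; rewrite /b; case: (@split 1 1 y).
- by move=> x; rewrite ord1 /g.
- by move=> [[x|x]|x]; rewrite ord1 /g /=.
- move=> z; right; case: z => -[|[|//]] h.
    by exists (inl (inl ord0)); apply: val_inj.
  by exists (inr ord0); apply: val_inj.
- by case.
- move=> x; rewrite /b; case: (@split_ordP 1 1 x) => y ->; apply: val_inj;
    by rewrite /= ord1.
- by exists (fun _ => inr (inl tt)) => [[[]|[[]|[]]]|[]].
- by move=> [[]|[[]|[]]].
- by move=> [[]|[[]|[]]].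
- by move=> [[]|[[]|[]]].
Qed.

(** Composing with an arc attaches one more edge, at the nodes where the first two
    inputs end, and creates no node. *)
Lemma arc_comp (N : finType) (e : arrow L N) (g : lgraph L N) m n
    (i : 'I_m -> N) (o : 'I_n -> N) :
  pcomp (ptens (circ_cls (arc_circuit e.1)) (pid (Circ L) m) : hom _ m (2 + m))
    (circ_cls (@Circuit L _ _ (Cospan (copair e.2 i) o) g)) =
  circ_cls (@Circuit L _ _ (Cospan i o) (add_arrow e g)).
Proof.
rewrite circ_cls_id circ_cls_tens [LHS]circ_cls_comp; apply/circ_clsP.
set c := circuit_tens _ _; set d := @Circuit L _ _ (Cospan (copair e.2 i) o) g.
apply: (@circuit_comp_eq _ _ _ _ c d
  (@Circuit L _ _ (Cospan i o) (add_arrow e g))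
  (sum_case e.2 i) id (fun z => po_in _ _ (inr z))
  (sum_map (sum_case id (of_void _)) id)) => //=.
- by move=> y; rewrite /copair; case: (@split 2 m y).
- move=> x; have [y <-] : exists y, rleg c y = x.
    case: x => x; [exists (lshift m x) | exists (rshift 2 x)].
      by rewrite /= split_l.
    by rewrite /= split_r.
  rewrite [RHS](po_glue (rleg c) (lleg d) y); congr (po_in _ _ (inr _)).
  by rewrite /= /copair; case: (@split 2 m y).
- by move=> z; right; exists z.
- move=> x; case: (@split_ordP 0 m x) => [[]//|y] -> /=.
  by congr i; apply: val_inj.
- by apply: sum_map_bij; [apply: sum_void_bij | ]; exists id.
- by move=> [[[]|[]]|x].
- by move=> [[[]|[]]|x].
- by move=> [[[]|[]]|x].
Qed.

Lemma interp_circ (N : finType) (es : seq (arrow L N)) m n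
    (i : 'I_m -> N) (o : 'I_n -> N) :
  interp cospan_incl edge_cls es i o =
    circ_cls (@Circuit L m n (Cospan i o) (arrows_graph es)).
Proof.
elim: es m i => [|e es IH] m i /=; first exact: cospan_inclE.
by rewrite IH arc_circ arc_comp.
Qed.

(** The edges of [arrows_graph] are nested sums, one summand per entry of the
    list; [k] reads the entry off a summand. *)
Lemma arrows_graph_edges (N : finType) (E : eqType) (f : E -> arrow L N)
    (xs : seq E) : uniq xs ->
  exists k : edge (arrows_graph (map f xs)) -> E,
    [/\ injective k, forall x, x \in xs <-> exists e, k e = x,
        forall e, src (arrows_graph (map f xs)) e = (f (k e)).2 ord_max,
        forall e, tgt (arrows_graph (map f xs)) e = (f (k e)).2 ord0
      & forall e, lab (arrows_graph (map f xs)) e = (f (k e)).1].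
Proof.
elim: xs => [|x xs IH] /= => [_|/andP[x_xs /IH[k [k_inj k_xs ks kt kl]]]].
  by exists (of_void E); split; try case; split=> // -[[]].
exists (sum_case (fun _ => x) k); split.
- move=> [[]|e] [[]|e'] //= xk.
  + by case/negP: x_xs; apply/k_xs; exists e'.
  + by case/negP: x_xs; apply/k_xs; exists e.
  + by rewrite (k_inj _ _ xk).
- move=> y; rewrite in_cons; split=> [/orP[/eqP->|/k_xs[e <-]]|[[[]|e] <-]] /=.
  + by exists (inl tt).
  + by exists (inr e).
  + by rewrite eqxx.
  + by apply/orP; right; apply/k_xs; exists e.
- by move=> [[]|e] /=.
- by move=> [[]|e] /=.
- by move=> [[]|e] /=.
Qed.

(** Every circuit is an expression in cospans and single edges: this is what makes
    a morphism out of the prop of circuits unique. *)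
Lemma circ_eval_circ m n (c : circuit L m n) :
  circ_eval cospan_incl edge_cls c = circ_cls c.
Proof.
rewrite /circ_eval interp_circ; apply/circ_clsP.
have [k [k_inj k_enum ks kt kl]] :=
  arrows_graph_edges (@endpoints L m n c) (enum_uniq (edge c)).
have k_surj e : exists x, k x = e by apply/k_enum; rewrite mem_enum.
have [k' k'K] := choice k_surj.
exists id, k; split=> //; first by split=> //; exists id.
by exists k' => // x; apply: k_inj.
Qed.

End Inclusions.

(** * The coproduct *)

Lemma interp_natural (L : Type) (D D' : prop) (F : morphism FinCospan D)
    (G : L -> hom D 1 1) (F' : morphism FinCospan D') (G' : L -> hom D' 1 1)
    (K : morphism D D') :
  mor_comp F K = F' -> (forall l, mfun K (G l) = G' l) ->
  forall (N : finType) (es : seq (arrow L N)) m n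
      (i : 'I_m -> N) (o : 'I_n -> N),
    mfun K (interp F G es i o) = interp F' G' es i o.
Proof.
move=> <- KG N; elim=> [|e es IH] m n i o //=.
have arcK : mfun K (arc F G e.1) = arc (mor_comp F K) G' e.1.
  rewrite /arc (mfun_comp K); congr pcomp.
  by rewrite [LHS](mfun_tens K (G e.1) (pid D 1)) KG mfun_id.
rewrite (mfun_comp K) IH; congr pcomp.
by rewrite [LHS](mfun_tens K (arc F G e.1) (pid D m)) arcK mfun_id.
Qed.

Theorem proposition3p2p8 (L : Type) :
  exists (i : morphism FinCospan (Circ L)) (j : morphism (FreeAction L) (Circ L)),
    is_coproduct i j.
Proof.
have [j jE] := action_incl_exists L.
exists (cospan_incl L), j => D F H.
pose G l := mfun H (label_gen l).
exists (circ_morphism F G); split; [split|].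
- apply: morphism_eq => m n; elim/cls_ind=> c /=.
  apply: (etrans (congr1 (@mfun _ _ (circ_morphism F G) m n) (cospan_inclE L c))).
  by rewrite circ_morphismE circ_eval_cospan.
- apply: action_morphism_eq => l.
  apply: (etrans (congr1 (@mfun _ _ (circ_morphism F G) 1 1) (jE l))).
  by rewrite [LHS]circ_morphismE circ_eval_edge.
- move=> K [KF KH]; apply: morphism_eq => m n; elim/cls_ind=> c.
  rewrite [LHS]circ_morphismE -[cls _ c]circ_eval_circ.
  rewrite (interp_natural (G' := G) KF) // => l.
  by rewrite -jE /G -KH.
Qed.
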